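(* Let $f$ be an ergodic p.m.p. action of the countable group $\Gamma$ on a standard Borel probability space $(X,\mathcal{B},\mu)$ and let $K$ be a compact topological space. If $f$ is strongly ergodic, then $\overline{E(f,K)}\subseteq E(\Gamma,K)$. If $f$ is not strongly ergodic, then $\overline{E(f,K)}$ is convex.
   Context: A p.m.p. (probability measure preserving) action $f$ of a countable group $\Gamma$ on a standard Borel probability space $(X,\mathcal{B},\mu)$ is a representation of each $\gamma\in\Gamma$ by $f_\gamma$ in the group of measure preserving transformations of $(X,\mathcal{B},\mu)$, with $f_{\gamma\delta}=f_\gamma f_\delta$. Weak containment: let $f$ and $g$ be p.m.p. actions of $\Gamma$ on $(X,\mathcal{B},\mu)$ and $(Y,\mathcal{C},\nu)$. Then $f$ weakly contains $g$ if for all Borel subsets $Y_1,\ldots,Y_n\in\mathcal{C}$, every finite set $S\subseteq\Gamma$ and every $\varepsilon>0$ there exist Borel subsets $X_1,\ldots,X_n\in\mathcal{B}$ such that $|\mu(f_\gamma X_i\cap X_j)-\nu(g_\gamma Y_i\cap Y_j)|<\varepsilon$ for all $1\le i,j\le n$ and $\gamma\in S$. An action of $\Gamma$ is strongly ergodic if it is ergodic and it does not weakly contain the identity (trivial) action of $\Gamma$ on two points with equal mass. For a compact topological space $K$, $K^{\Gamma}$ (maps from $\Gamma$ to $K$, product topology) carries the continuous shift action of $\Gamma$, $(\delta\cdot\omega)(\gamma)=\omega(\gamma\delta)$. $M(\Gamma,K)$ denotes the set of $\Gamma$-invariant Borel probability measures on $K^{\Gamma}$, endowed with the weak* topology, and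 $E(\Gamma,K)\subseteq M(\Gamma,K)$ denotes the set of ergodic measures. Any Borel map $\phi:X\to K$ defines a $\Gamma$-equivariant map $\Phi:X\to K^{\Gamma}$ by $\Phi(x)(\gamma)=\phi(f_\gamma(x))$ for $x\in X$, $\gamma\in\Gamma$. Write $\Phi\circ\mu$ for the push-forward of $\mu$ under $\Phi$, an invariant measure on $K^\Gamma$. Set $$E(f,K)=\{\Phi\circ\mu\mid\phi\text{ a Borel map from }X\text{ to }K\}\subseteq M(\Gamma,K),$$ and let $\overline{E(f,K)}$ be its closure in $M(\Gamma,K)$ in the weak* topology.
   Formalization: Measures on K^Γ are taken on the Baire sets (generated by continuous real functions) instead of all Borel sets; this agrees with Borel for metrizable K and with regular Borel measures for compact Hausdorff K, and with all Borel measures the claim fails for some compact K. K is nonempty. *)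

(* Defs.v *)
From HB Require Import structures.
From mathcomp Require Import all_boot all_order all_algebra.
From mathcomp Require Import all_classical all_reals all_analysis.
From mathcomp Require Import measurable_realfun finmap.

Set Implicit Arguments.
Unset Strict Implicit.
Unset Printing Implicit Defensive.

Import Order.TTheory GRing.Theory Num.Theory.
Import numFieldNormedType.Exports.
Local Open Scope classical_set_scope.
Local Open Scope ring_scope.

(* Isomorphic, as a measurable space, to a Polish space with its Borel sets. *)
Definition standard_borel (R : realType) d (X : measurableType d) : Prop :=
  exists (Y : completePseudoMetricType R) (e : X -> Y),
    [/\ hausdorff_space Y,
        exists2 D : set Y, countable D & dense D,
        bijective e &
        forall A : set X, measurable A <-> <<s @open Y >> (e @` A)].

Definition preserves d (X : measurableType d) (R : realType)
    (mu : probability X R) (T : X -> X) : Prop :=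
  forall A, measurable A -> mu (T @^-1` A) = mu A.

(* The action laws hold at every point; each [f g] is then a bijection with
   measurable inverse [f g^-1]. *)
Record pmp_action (G : groupType) d (X : measurableType d) (R : realType)
    (mu : probability X R) (f : G -> X -> X) : Prop := PmpAction {
  pmp_act1 : forall x, f 1%g x = x ;
  pmp_actM : forall g h x, f (g * h)%g x = f g (f h x) ;
  pmp_measurable : forall g, measurable_fun [set: X] (f g) ;
  pmp_preserves : forall g, preserves mu (f g) }.

Definition ergodic (G : groupType) d (X : measurableType d) (R : realType)
    (mu : probability X R) (f : G -> X -> X) : Prop :=
  forall A, measurable A -> (forall g, f g @^-1` A = A) ->
    mu A = 0%E \/ mu A = 1%E.

Definition weakly_contains (G : groupType) (R : realType)
    d (X : measurableType d) (mu : probability X R) (f : G -> X -> X)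
    d' (Y : measurableType d') (nu : probability Y R) (g : G -> Y -> Y) : Prop :=
  forall (n : nat) (B : 'I_n -> set Y), (forall i, measurable (B i)) ->
  forall S : set G, finite_set S ->
  forall eps : R, 0 < eps ->
  exists2 A : 'I_n -> set X, (forall i, measurable (A i)) &
    forall (i j : 'I_n) (s : G), S s ->
      (`| mu (f s @` A i `&` A j) - nu (g s @` B i `&` B j) | < eps%:E)%E.

Definition trivial_action (G : groupType) (T : Type) : G -> T -> T :=
  fun _ x => x.

(* [bernoulli_prob 2^-1] gives mass 1/2 to each of the two points of [bool]. *)
Definition strongly_ergodic (G : groupType) d (X : measurableType d)
    (R : realType) (mu : probability X R) (f : G -> X -> X) : Prop :=
  ergodic mu f /\
  ~ weakly_contains mu f (bernoulli_prob (2^-1 : R)) (@trivial_action G bool).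

(* K^G with the product topology *)
Definition config (G K : Type) := {ptws G -> K}.
HB.instance Definition _ (G : Type) (K : topologicalType) :=
  Topological.on (config G K).
HB.instance Definition _ (G : Type) (K : ptopologicalType) :=
  Pointed.on (config G K).

Definition shift (G : groupType) (K : Type) (h : G) (w : config G K) :
    config G K :=
  fun g => w (g * h)%g.

(* [<<s baire_generators R T >>] is the smallest sigma-algebra making every
   continuous function [T -> R] measurable.  The weak* topology only sees a
   measure through the integrals of continuous functions, and these determine
   it exactly on this sigma-algebra, so measures on K^G are taken here: by the
   Riesz representation theorem they are the states of C(K^G), i.e. the regular
   Borel probability measures when K is compact Hausdorff.  For metrizable K
   and countable G this is the Borel sigma-algebra of K^G
   ([baire_borel_config]).  For non-metrizable K the Borel sigma-algebra of K^G
   can be strictly larger; then the map [equivariant_map f phi] below need not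
   be Borel measurable, and Borel measures with equal integrals of continuous
   functions need not be equal, nor be simultaneously ergodic. *)
Definition baire_generators (R : realType) (T : topologicalType) :
    set (set T) :=
  [set A | exists (h : T -> R) (U : set R),
     [/\ continuous h, open U & A = h @^-1` U]].
Arguments baire_generators : clear implicits.

Lemma baire_sub_borel (R : realType) (T : topologicalType) :
  <<s baire_generators R T >> `<=` <<s @open T >>.
Proof.
apply: smallest_sub; first exact: smallest_sigma_algebra.
move=> _ [h [U [ch oU ->]]]; apply: sub_sigma_algebra.
by apply: open_comp => // x _; exact: ch.
Qed.

Lemma baire_borel_metric (R : realType) (T : pseudoMetricType R) :
  <<s baire_generators R T >> = <<s @open T >>.
Proof.
apply/seteqP; split; first exact: baire_sub_borel.
apply: smallest_sub; first exact: smallest_sigma_algebra.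
move=> U oU.
pose F (n : nat) := [set x : T | ball x n.+1%:R^-1 `<=` U].
have /choice[h hP] n : exists h : T -> R,
    [/\ continuous h, range h `<=` `[0, 1],
        h @` F n `<=` [set 0] & h @` (~` U) `<=` [set 1]].
  apply/uniform_separatorP.
  exists (Uniform.class T), [set xy | ball xy.1 n.+1%:R^-1 xy.2]; split => //.
  - have n0 : 0 < n.+1%:R^-1 :> R by rewrite invr_gt0.
    exact: (@entourage_ball _ T (PosNum n0)).
  - by rewrite -subset0 => -[x y] [[/= Fx Uy]] /Fx.
  - by move=> x A.
suff -> : U = \bigcup_n (h n @^-1` [set r | r < 1]).
  apply: sigma_algebra_bigcup => n; apply: sub_sigma_algebra.
  exists (h n), [set r | r < 1]; split => //; by have [] := hP n.
apply/seteqP; split => [x Ux|x [n _ /=]].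
  have /nbhs_ballP[e /= e0 eU] : nbhs x U by exact: open_nbhs_nbhs.
  near \oo => n; exists n => //=.
  suff -> : h n x = 0 by [].
  have [_ _ h0 _] := hP n; apply: h0; exists x => // y /= xy; apply: eU.
  apply: le_ball xy; apply/ltW; near: n.
  exact: near_infty_natSinv_lt (PosNum e0).
move=> hx; apply: contrapT => nUx; have [_ _ _ h1] := hP n.
by move: hx; rewrite (h1 (h n x)) ?ltxx//; exists x.
Unshelve. all: by end_near. Qed.

Lemma baire_borel_config (R : realType) (G : Type)
    (K : pseudoMetricType R) : countable [set: G] ->
  <<s baire_generators R (config G K) >> = <<s @open (config G K) >>.
Proof.
move=> /countable_injP[f finj].
pose g n := if pselect (exists x : G, f x = n) is left e
  then Some (projT1 (cid e)) else None.
have fK : pcancel (f : {classic G} -> nat) g.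
  move=> x; rewrite /g; case: pselect => [e|[]]; last by exists x.
  by congr Some; apply: finj; rewrite ?in_setT//; case: (cid e).
pose C : countType := HB.pack {classic G} (PCanIsCountable fK).
exact: (@baire_borel_metric R (@prod_topology C (fun=> K))).
Qed.

Definition equivariant_map (G K X : Type) (f : G -> X -> X) (phi : X -> K) :
    X -> config G K :=
  fun x g => phi (f g x).

Definition baireConfig (R : realType) (G : Type) (K : ptopologicalType) :=
  g_sigma_algebraType (baire_generators R (config G K)).

HB.instance Definition _ (R : realType) (G : Type) (K : ptopologicalType) :=
  Measurable.on (baireConfig R G K).

(* So every Borel map into K gives a push-forward, metrizable K or not. *)
Section measurable_equivariant_map.
Context (R : realType) (G : groupType) (K : ptopologicalType).
Context d (X : measurableType d) (f : G -> X -> X) (phi : X -> K).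
Hypothesis K_compact : compact [set: K].
Hypothesis mf : forall g, measurable_fun [set: X] (f g).
Hypothesis mphi :
  measurable_fun [set: X] (phi : X -> g_sigma_algebraType (@open K)).
Let Phi : X -> config G K := equivariant_map f phi.

Let open_nbhs_cylinder (w : config G K) (U : set (config G K)) : nbhs w U ->
  exists V, [/\ open V, V w, V `<=` U & measurable (Phi @^-1` V)].
Proof.
rewrite nbhsE => -[_ [[B sB <-] [C BC Cw]] BU].
have [D sD DC] := sB _ BC; exists C; split => //.
- by exists [set C]; [move=> _ ->; exact: sB|rewrite bigcup_set1].
- by move=> x Cx; apply: BU; exists C.
rewrite -DC preimage_bigcap; apply: fin_bigcap_measurable => // E DE.
have /sD := DE; move=> /set_mem[g _ [V oV <-]].
rewrite -[X in measurable X]setTI.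
have := measurableT_comp mphi (mf g); apply => //.
exact: sub_sigma_algebra.
Qed.

Lemma measurable_equivariant_map :
  measurable_fun [set: X] (equivariant_map f phi : X -> baireConfig R G K).
Proof.
have mcont (h : config G K -> R) : continuous h ->
    measurable_fun [set: X] (h \o Phi).
  move=> ch; apply: (measurability _ (RGenOInfty.measurableE R)) => //.
  move=> _ [_ [a ->] <-]; rewrite setTI.
  pose F n := h @^-1` [set r | a + n.+1%:R^-1 <= r].
  have cF n : compact (F n).
    apply: (subclosed_compact _ (_ : compact [set: config G K])) => //.
      by apply: preimage_closed => //; exact: closed_ge.
    have := @tychonoff {classic G} (fun=> K) (fun=> setT) (fun=> K_compact).
    by congr compact; apply/seteqP; split.
  have /choice[V VP] n : exists V, [/\ F n `<=` V, V `<=` h @^-1` `]a, +oo[ &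
      measurable (Phi @^-1` V)].
    have : forall w, F n w -> exists V, [/\ open V, V w,
        V `<=` h @^-1` `]a, +oo[ & measurable (Phi @^-1` V)].
      move=> w Fw; apply: open_nbhs_cylinder; apply: ch.
      apply: open_nbhs_nbhs; split; first exact: interval_open.
      by rewrite /= in_itv/= andbT (lt_le_trans _ Fw)// ltrDl invr_gt0.
    move=> H; have /choice[W WP] w : exists V, F n w -> [/\ open V, V w,
        V `<=` h @^-1` `]a, +oo[ & measurable (Phi @^-1` V)].
      by have [/H[V ?]|?] := pselect (F n w); [exists V|exists setT].
    have := cF n; rewrite compact_cover => /(_ _ (F n) W).
    case=> [w /WP[]//|w Fw|D DF FD]; first by exists w => //; case: (WP _ Fw).
    exists (\bigcup_(i in [set` D]) W i); split => //.
      by move=> x [w /= /DF/set_mem/WP[_ _ + _] Wx]; exact.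
    rewrite preimage_bigcup; apply: fin_bigcup_measurable => // w.
    by move=> /= /DF/set_mem/WP[].
  rewrite (_ : _ @^-1` _ = \bigcup_n (Phi @^-1` V n)).
    by apply: bigcup_measurable => n _; have [] := VP n.
  apply/seteqP; split => [x /=|x [n _ /=]].
    rewrite in_itv/= andbT => ax.
    have [n _ nx] : exists2 n, True & a + n.+1%:R^-1 <= h (Phi x).
      near \oo => n; exists n => //; rewrite -lerBrDl; apply/ltW; near: n.
      by apply: (near_infty_natSinv_lt (PosNum _)); rewrite subr_gt0.
    by exists n => //; have [+ _ _] := VP n; apply.
  by have [_ + _] := VP n => /[apply].
apply: (@measurability _ _ _ (baireConfig R G K) setT _
  (baire_generators R (config G K)) erefl) => //.
move=> _ [_ [h [U [ch oU ->]]] <-].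
exact: (mcont h ch measurableT _ (open_measurable oU)).
Unshelve. all: by end_near. Qed.
End measurable_equivariant_map.

Section config_measures.
Context (R : realType) (G : groupType) (K : ptopologicalType).
Local Notation KG := (baireConfig R G K).

Definition invariant_measures : set (probability KG R) :=
  [set nu : probability KG R | forall g, preserves nu (@shift G K g)].

Definition ergodic_measures : set (probability KG R) :=
  [set nu : probability KG R | invariant_measures nu /\ ergodic nu (@shift G K)].

(* The initial topology for the maps [nu |-> \int h dnu], [h] continuous. *)
Definition integrals (nu : probability KG R) :
    {ptws {h : config G K -> R | continuous h} -> R} :=
  fun h => \int[nu]_w (sval h w).

Definition weakstar := initial_topology integrals.

(* Closure in [invariant_measures] for the subspace topology. *)
Definition weakstar_closure (E : set (probability KG R)) :
    set (probability KG R) :=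
  invariant_measures `&` closure (E : set weakstar).

(* The values of a [probability] off the measurable sets are arbitrary, so
   equality with the push-forward is required on measurable sets only. *)
Definition factor_measures d (X : measurableType d) (mu : probability X R)
    (f : G -> X -> X) : set (probability KG R) :=
  [set nu : probability KG R | exists2 phi : X -> K,
     measurable_fun [set: X] (phi : X -> g_sigma_algebraType (@open K)) &
     forall A, measurable A ->
       nu A = pushforward mu (equivariant_map f phi : X -> KG) A].

End config_measures.

Section mixture.
Context d (T : measurableType d) (R : realType).
Context (t : {i01 R}) (m1 m2 : probability T R).

Definition mixture : set T -> \bar R :=
  measure_add (mscale t%:num%:nng m1) (mscale (1 - t%:num)%:nng m2).

HB.instance Definition _ := Measure.on mixture.

Let mixtureT : mixture setT = 1%E.
Proof.
by rewrite /mixture measure_addE/= /mscale/= !probability_setT !mule1 -EFinD subrKC.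
Qed.

HB.instance Definition _ := Measure_isProbability.Build _ _ _ mixture mixtureT.

Lemma mixtureE A :
  mixture A = (t%:num%:E * m1 A + (1 - t%:num)%R%:E * m2 A)%E.
Proof. by rewrite /mixture measure_addE. Qed.

End mixture.

Definition convex_measures d (T : measurableType d) (R : realType)
    (E : set (probability T R)) : Prop :=
  forall (t : {i01 R}) (m1 m2 : probability T R),
    E m1 -> E m2 -> E (mixture t m1 m2).

(* Main.v *)
(* A set is almost invariant if it is moved little by finitely many group
   elements.  If mu(A_n) -> a along an asymptotically invariant sequence, then
   mu(A_n `&` B) -> a mu(B) for every B: any ultrafilter limit of
   mu(A_n `&` -) - a mu is an invariant charge dominated by mu, and by
   ergodicity its Hahn decomposition is trivial.  So the possible masses of
   almost invariant sets form a closed set stable under products and a |-> 1 - a;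
   if it contains a point of ]0, 1[ it is [0, 1], and it contains 1/2 exactly
   when f weakly contains the trivial action on two points of equal mass.

   Strongly ergodic case: let nu be in the closure and A invariant.  Approximate
   1_A by a continuous h; for phi with Phi o mu close to nu, the set
   {h o Phi > 1/2} is almost invariant of mass close to nu(A), so nu(A) is 0 or 1.

   Other case: choose A_n asymptotically invariant of mass t and set phi_n = phi_1
   on A_n, phi_2 off A_n.  A continuous function on K^G essentially depends on
   finitely many coordinates, so Phi_n o mu converges to
   t (Phi_1 o mu) + (1 - t) (Phi_2 o mu); mixing is separately continuous, so
   the convexity passes to the closure. *)
Require Import Defs.
From HB Require Import structures.
From mathcomp Require Import all_boot all_order all_algebra finmap.
From mathcomp Require Import all_classical all_reals all_analysis.
From mathcomp Require Import measurable_realfun ring lra.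

Set Implicit Arguments.
Unset Strict Implicit.
Unset Printing Implicit Defensive.

Import Order.TTheory GRing.Theory Num.Theory.
Import numFieldNormedType.Exports.
Local Open Scope classical_set_scope.
Local Open Scope ring_scope.

(** * Masses of sets under a measure preserving action *)

(** If a neighbourhood [V] fails, the trace of [F] on the complement of its preimage is a proper
    filter. An ultrafilter containing that trace refines [F], so it would contain both the preimage
    and its complement. *)
Lemma cvg_ultra (I : Type) (F : set_system I) (Y : topologicalType)
    (u : I -> Y) (l : Y) : ProperFilter F ->
  (forall U, UltraFilter U -> F `<=` U -> u @ U --> l) -> u @ F --> l.
Proof.
move=> FF h V Vl; apply: contrapT => nFV.
pose W := ~` (u @^-1` V).
have WF : ProperFilter (within W F).
  apply: Build_ProperFilter_ex => B FB.
  apply: contrapT => B0; apply: nFV; change (F (u @^-1` V)).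
  have : F [set x | W x -> B x] by exact: FB.
  apply: filterS => x /= Bx; apply: contrapT => Vx.
  by apply: B0; exists x; exact: Bx.
have [U [UU WU]] := ultraFilterLemma WF.
have FU : F `<=` U.
  by move=> B FB; apply: WU; rewrite /within/=; apply: filterS FB => x.
have UV : U (u @^-1` V) := h U UU FU V Vl.
have UW : U W by apply: WU; exact: withinT.
by have [x []] := filter_ex (filterI UV UW).
Qed.

(** Masses are taken as reals rather than extended reals, so that ordinary arithmetic applies to
    them. *)
Definition pr d (T : measurableType d) (R : realType) (P : probability T R)
  (A : set T) : R := fine (P A).

Section pr_lemmas.
Context d (T : measurableType d) (R : realType) (P : probability T R).
Implicit Types A B : set T.

Lemma prE A : measurable A -> (pr P A)%:E = P A.
Proof. by move=> mA; rewrite fineK// fin_num_measure. Qed.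

Lemma pr_ge0 A : 0 <= pr P A.
Proof. exact: fine_ge0. Qed.

Lemma pr_le A B : measurable A -> measurable B -> A `<=` B ->
  pr P A <= pr P B.
Proof.
by move=> mA mB AB; rewrite -lee_fin !prE// le_measure// inE.
Qed.

Lemma prT : pr P setT = 1.
Proof. by rewrite /pr probability_setT. Qed.

Lemma pr0 : pr P set0 = 0.
Proof. by rewrite /pr measure0. Qed.

Lemma pr_le1 A : measurable A -> pr P A <= 1.
Proof. by move=> mA; rewrite -prT pr_le. Qed.

Lemma prU A B : measurable A -> measurable B -> A `&` B = set0 ->
  pr P (A `|` B) = pr P A + pr P B.
Proof.
move=> mA mB AB; apply: EFin_inj; rewrite EFinD !prE ?measureU//.
exact: measurableU.
Qed.

Lemma prDI A B : measurable A -> measurable B ->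
  pr P A = pr P (A `\` B) + pr P (A `&` B).
Proof.
move=> mA mB; rewrite -prU.
- by rewrite setDE -setIUr setUC setUv setIT.
- exact: measurableD.
- exact: measurableI.
- by rewrite setDE setIACA setICl setI0.
Qed.

Lemma prU_le A B : measurable A -> measurable B ->
  pr P (A `|` B) <= pr P A + pr P B.
Proof.
move=> mA mB; rewrite (@prDI (A `|` B) A)//; last exact: measurableU.
rewrite addrC lerD// pr_le//; do ?[exact: measurableI|exact: measurableU|
  exact: measurableD].
- by apply: measurableI => //; exact: measurableU.
- by apply: measurableD => //; exact: measurableU.
- by move=> x [[]].
Qed.

Lemma prC A : measurable A -> pr P (~` A) = 1 - pr P A.
Proof.
move=> mA; rewrite -prT (@prDI setT A)// setTD setTI addrK//.
Qed.

End pr_lemmas.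

Section action.
Context (R : realType) (G : groupType) d (X : measurableType d).
Context (mu : probability X R) (f : G -> X -> X).
Hypothesis f_pmp : pmp_action mu f.
Implicit Types A B : set X.
Local Notation m := (pr mu).

Lemma measurable_preimage_action g A : measurable A -> measurable (f g @^-1` A).
Proof.
move=> mA; rewrite -[X in measurable X]setTI.
exact: (pmp_measurable f_pmp).
Qed.

Lemma pr_preimage_action g A : measurable A -> m (f g @^-1` A) = m A.
Proof. by move=> mA; rewrite /pr (pmp_preserves f_pmp). Qed.

Lemma actionVK g : cancel (f g) (f g^-1%g).
Proof. by move=> x; rewrite -(pmp_actM f_pmp) mulVg (pmp_act1 f_pmp). Qed.

Lemma actionK g : cancel (f g^-1%g) (f g).
Proof. by move=> x; rewrite -(pmp_actM f_pmp) mulgV (pmp_act1 f_pmp). Qed.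

Lemma image_action g A : f g @` A = f g^-1%g @^-1` A.
Proof.
apply/seteqP; split => [_ [x Ax <-]|x Ax] /=; first by rewrite actionVK.
by exists (f g^-1%g x) => //; rewrite actionK.
Qed.

(** [A] and its preimage have the same mass, so removing their common part leaves equal masses on
    both sides. *)
Lemma pr_setD_action g A : measurable A ->
  m (A `\` f g @^-1` A) = m (f g @^-1` A `\` A).
Proof.
move=> mA; have mfA := measurable_preimage_action g mA.
have := prDI mu mA mfA; have := prDI mu mfA mA.
by rewrite pr_preimage_action// setIC => -> /addIr.
Qed.

(** Moving the whole intersection by [g] preserves its mass; what remains is to exchange [A] with
    its preimage, and each direction costs one half of their symmetric difference. *)
Lemma dist_pr_action g A B : measurable A -> measurable B ->
  `|m (A `&` f g @^-1` B) - m (A `&` B)| <= 2 * m (f g @^-1` A `\` A).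
Proof.
move=> mA mB; have mfA := measurable_preimage_action g mA.
have mfB := measurable_preimage_action g mB.
rewrite -(pr_preimage_action g (measurableI _ _ mA mB)) preimage_setI.
have mAB := measurableI _ _ mA mfB; have mfAB := measurableI _ _ mfA mfB.
have h1 : m (A `&` f g @^-1` B) <= m (f g @^-1` A `&` f g @^-1` B) + m (A `\` f g @^-1` A).
  apply: le_trans (prU_le _ _ _) => //; last exact: measurableD.
  apply: pr_le => //; first by apply: measurableU => //; exact: measurableD.
  by move=> x [Ax Bx]; have [?|?] := pselect (A (f g x)); [left|right].
have h2 : m (f g @^-1` A `&` f g @^-1` B) <= m (A `&` f g @^-1` B) + m (f g @^-1` A `\` A).
  apply: le_trans (prU_le _ _ _) => //; last exact: measurableD.
  apply: pr_le => //; first by apply: measurableU => //; exact: measurableD.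
  by move=> x [Ax Bx]; have [?|?] := pselect (A x); [left|right].
rewrite pr_setD_action// in h1; have := pr_ge0 mu (f g @^-1` A `\` A).
by rewrite ler_norml; lra.
Qed.

End action.

(** * Invariant charges and asymptotic independence *)

(** What a finite subunion misses has [l]-value at most its [mu]-mass, and that mass tends to 0:
    domination transfers countable additivity from [mu] to [l]. *)
Lemma dominated_sigma_additive d (X : measurableType d) (R : realType)
    (mu : probability X R) (l : set X -> R) :
  (forall A, measurable A -> 0 <= l A <= pr mu A) ->
  (forall A B, measurable A -> measurable B -> A `&` B = set0 ->
    l (A `|` B) = l A + l B) ->
  forall F : nat -> set X, (forall n, measurable (F n)) -> trivIset setT F ->
  \sum_(0 <= i < n) l (F i) @[n --> \oo] --> l (\bigcup_n F n).
Proof.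
move=> l0m lU F mF tF.
have l0 : l set0 = 0.
  by apply: le_anti; rewrite andbC -{2}(pr0 mu) l0m.
have mUF n : measurable (\big[setU/set0]_(i < n) F i).
  by apply: bigsetU_measurable => i _; exact: mF.
have mBF : measurable (\bigcup_n F n) by exact: bigcup_measurable.
have sumE (h : set X -> R) : h set0 = 0 -> (forall A B, measurable A ->
    measurable B -> A `&` B = set0 -> h (A `|` B) = h A + h B) ->
    forall n, \sum_(0 <= i < n) h (F i) = h (\big[setU/set0]_(i < n) F i).
  move=> h0 hU; elim => [|n IH]; first by rewrite big_nil big_ord0 h0.
  rewrite big_nat_recr//= IH big_ord_recr/= hU//; first exact: mUF.
  apply/seteqP; split => // x []; rewrite -bigcup_mkord => -[k /= kn Fk] Fn.
  have kn' : k = n by apply: tF => //; exists x.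
  by rewrite kn' ltnn in kn.
have subUF n : \big[setU/set0]_(i < n) F i `<=` \bigcup_n F n.
  by rewrite -bigcup_mkord => x [k _ Fk]; exists k.
have mcvg : pr mu (\big[setU/set0]_(i < n) F i) @[n --> \oo] -->
    pr mu (\bigcup_n F n).
  have : (\sum_(0 <= i < n) mu (F i))%E @[n --> \oo] -->
      (pr mu (\bigcup_n F n))%:E.
    by rewrite prE//; exact: measure_semi_sigma_additive.
  move=> /fine_cvg; apply: cvg_trans.
  apply: near_eq_cvg; apply: nearW => n /=.
  rewrite -(sumE (pr mu) (pr0 mu)); last by move=> A B mA mB; exact: prU.
  rewrite sum_fine// => i _; exact: fin_num_measure.
have dist n : `|l (\bigcup_n F n) - l (\big[setU/set0]_(i < n) F i)| <=
    pr mu (\bigcup_n F n) - pr mu (\big[setU/set0]_(i < n) F i).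
  have mD := measurableD mBF (mUF n).
  have UD : \bigcup_n F n = (\bigcup_n F n `\` \big[setU/set0]_(i < n) F i)
      `|` \big[setU/set0]_(i < n) F i.
    by rewrite setUC setDUK.
  have D0 : (\bigcup_n F n `\` \big[setU/set0]_(i < n) F i) `&`
      \big[setU/set0]_(i < n) F i = set0 by rewrite setDKI.
  rewrite [in l _]UD [in pr mu (\bigcup_n F n)]UD prU// lU// !addrK.
  by have /andP[h0 h1] := l0m _ mD; rewrite ger0_norm.
rewrite (_ : (fun n => _) = fun n => l (\big[setU/set0]_(i < n) F i)); last first.
  by apply/funext => n; rewrite sumE.
apply/cvgrPdist_le => e e0; move/cvgrPdist_le : mcvg => /(_ e e0).
apply: filterS => n; apply: le_trans; apply: (le_trans (dist n)).
exact: ler_norm.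
Qed.

Section ergodic_charge.
Context (R : realType) (G : groupType) d (X : measurableType d).
Context (mu : probability X R) (f : G -> X -> X) (e : nat -> G).
Hypothesis f_pmp : pmp_action mu f.
Hypothesis f_erg : ergodic mu f.
Hypothesis e_surj : forall g, exists n, e n = g.
Implicit Types A B : set X.
Local Notation m := (pr mu).

(** Saturating the negative half of a Hahn decomposition under the group gives an invariant negative
    set [M] with positive complement. By ergodicity [M] is null or conull, so [s] has constant sign,
    and constant sign with total mass 0 forces [s] to vanish. *)
Lemma invariant_charge_eq0 (s : {charge set X -> \bar R}) :
  (forall g B, measurable B -> s (f g @^-1` B) = s B) ->
  (forall B, measurable B -> mu B = 0%E -> s B = 0%E) ->
  s setT = 0%E -> forall B, measurable B -> s B = 0%E.
Proof.
move=> sf smu sT.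
have [P [N [[mP posP] [mN negN] PN _]]] := Hahn_decomposition s.
pose M := \bigcup_n (f (e n) @^-1` N).
have [mM negM] : negative_set s M.
  apply: bigcup_negative_set => n; split.
    exact: (measurable_preimage_action f_pmp).
  move=> A mA AN; rewrite -(sf (e n)^-1%g)//; apply: negN.
    exact: (measurable_preimage_action f_pmp).
  by move=> x /AN /=; rewrite (actionK f_pmp).
(* The translate by the identity occurs in [M], so [M] contains [N], and a set that misses [M] lies
   in [P]. *)
have posMC A : measurable A -> A `&` M = set0 -> (0 <= s A)%E.
  move=> mA AM; apply: posP => // x Ax.
  have : (P `|` N) x by rewrite PN.
  case=> // Nx; have [n en] := e_surj 1%g.
  have : (A `&` M) x by split => //; exists n => //=; rewrite en (pmp_act1 f_pmp).
  by rewrite AM.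
have invM g : f g @^-1` M = M.
  apply/seteqP; split => x [n _ /= Nx].
    have [k ek] := e_surj (e n * g)%g.
    by exists k => //=; rewrite ek (pmp_actM f_pmp).
  have [k ek] := e_surj (e n * g^-1)%g.
  by exists k => //=; rewrite ek (pmp_actM f_pmp) (actionVK f_pmp).
have sC B : measurable B -> (s B + s (~` B) = 0)%E.
  move=> mB; rewrite -chargeU ?setUv ?sT ?setICr//; exact: measurableC.
have smuI A B : measurable A -> measurable B -> mu B = 0%E -> s (A `&` B) = 0%E.
  move=> mA mB B0; have mAB := measurableI _ _ mA mB.
  apply: smu => //; apply: subset_measure0 B0 => //.
have nonneg0 : (forall B, measurable B -> 0 <= s B)%E ->
    forall B, measurable B -> s B = 0%E.
  move=> s0 B mB; have sBC := sC B mB.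
  have mCB := measurableC mB.
  have := s0 B mB; rewrite le_eqVlt => /predU1P[//|sB].
  have := s0 _ mCB; move: sBC => /[swap] sCB /eqP.
  by rewrite gt_eqF// -[ltLHS]adde0 lte_leD.
have nonpos0 : (forall B, measurable B -> s B <= 0)%E ->
    forall B, measurable B -> s B = 0%E.
  move=> s0 B mB; have sBC := sC B mB.
  have mCB := measurableC mB.
  have := s0 B mB; rewrite le_eqVlt => /predU1P[//|sB].
  have := s0 _ mCB; move: sBC => /[swap] sCB /eqP.
  by rewrite lt_eqF// -[ltRHS]adde0 lte_leD// fin_num_measure.
have [M0|M1] := f_erg mM invM.
  apply: nonneg0 => B mB.
  rewrite (chargeDI _ mB mM) (smuI _ _ mB mM M0) adde0 posMC//.
    exact: measurableD.
  by rewrite setDKI.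
apply: nonpos0 => B mB.
have mMC := measurableC mM.
rewrite (chargeDI _ mB mMC) (smuI _ _ mB mMC).
  rewrite adde0; apply: negM; first exact: measurableD.
  by rewrite setDE setCK; exact: subIsetr.
by rewrite probability_setC// M1 subee.
Qed.

End ergodic_charge.

(** A one-sided difference is enough: by [pr_setD_action] the other side has the same mass. *)
Definition asymptotically_invariant (R : realType) (G : groupType) d
    (X : measurableType d) (mu : probability X R) (f : G -> X -> X)
    (A : nat -> set X) : Prop :=
  (forall n, measurable (A n)) /\
  forall g, pr mu (f g @^-1` A n `\` A n) @[n --> \oo] --> (0 : R).

Section mixing.
Context (R : realType) (G : groupType) d (X : measurableType d).
Context (mu : probability X R) (f : G -> X -> X) (e : nat -> G).
Hypothesis f_pmp : pmp_action mu f.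
Hypothesis f_erg : ergodic mu f.
Hypothesis e_surj : forall g, exists n, e n = g.
Implicit Types B : set X.
Local Notation m := (pr mu).

(** Convergence is tested along ultrafilters, where the limits exist for all measurable sets at once
    and depend additively on the set. *)
Lemma cvg_pr_setI (A : nat -> set X) (a : R) :
  asymptotically_invariant mu f A -> m (A n) @[n --> \oo] --> a ->
  forall B, measurable B -> m (A n `&` B) @[n --> \oo] --> a * m B.
Proof.
move=> [mA Ainv] Aa B0 mB0; apply: cvg_ultra => U UU oU.
have PU : ProperFilter U by exact: ultra_proper.
have cvgU (u : nat -> R) l : u @ \oo --> l -> u @ U --> l.
  by apply: cvg_trans; exact: cvg_app.
pose l B : R := lim (m (A n `&` B) @[n --> U]).
have lcvg B : measurable B -> m (A n `&` B) @[n --> U] --> l B.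
  move=> mB.
  have u01 n : `[0, 1]%classic (m (A n `&` B)).
    by rewrite /= in_itv/= pr_ge0 pr_le1//; exact: measurableI.
  pose u n := m (A n `&` B).
  have [p [_ up]] : `[0, 1]%classic `&` [set p | u @ U --> p] !=set0.
    have U01 : (u @ U) `[0, 1]%classic.
      by rewrite /fmap/=; apply: filterE; exact: u01.
    (* A cluster point exists by compactness of the unit interval, and a cluster point of an
       ultrafilter is a limit. *)
    have [p [p01 clp]] := @segment_compact R 0 1 (u @ U) _ U01.
    exists p; split => // V pV; apply: contrapT => nUV.
    have [//|UVC] := in_ultra_setVsetC (u @^-1` V) UU.
    by have [x []] := clp (~` V) V UVC pV.
  by apply/cvg_ex; exists p.
have l01 B : measurable B -> 0 <= l B <= m B.
  move=> mB; apply/andP; split.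
    apply: limr_ge; first by apply/cvg_ex; exists (l B); exact: lcvg.
    by apply: nearW => n; exact: pr_ge0.
  apply: limr_le; first by apply/cvg_ex; exists (l B); exact: lcvg.
  by apply: nearW => n; apply: pr_le => //; exact: measurableI.
have lU B C : measurable B -> measurable C -> B `&` C = set0 ->
    l (B `|` C) = l B + l C.
  move=> mB mC BC; have mBC := measurableU _ _ mB mC.
  apply: cvg_lim => //; apply: cvg_trans (cvgD (lcvg _ mB) (lcvg _ mC)).
  apply: near_eq_cvg; apply: nearW => n /=.
  rewrite setIUr prU//; do ?exact: measurableI.
  by rewrite setIACA BC setI0.
have lT : l setT = a.
  by apply: cvg_lim => //; under eq_fun do rewrite setIT; exact: cvgU.
have lf g B : measurable B -> l (f g @^-1` B) = l B.
  move=> mB; have mfB := measurable_preimage_action f_pmp g mB.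
  (* Moving [B] by [g] changes the mass of its intersection with [A n] by at most twice the
     invariance defect of [A n], which tends to 0. *)
  apply: cvg_lim => //; apply: cvg_sub0 (lcvg _ mB); apply: norm_cvg0.
  apply: (@squeeze_cvgr _ _ _ _ (cst 0)
    (fun n => 2 * m (f g @^-1` A n `\` A n))).
  - by apply: nearW => n; rewrite normr_ge0 (dist_pr_action f_pmp).
  - exact: cvg_cst.
  - by rewrite -(mulr0 2); apply: cvgM; [exact: cvg_cst|apply: cvgU].
pose s B : \bar R := (l B - a * m B)%:E.
have s0 : s set0 = 0%E.
  have := l01 _ (@measurable0 _ X); rewrite /s pr0 => /le_anti <-.
  by rewrite mulr0 subr0.
have sfin B : measurable B -> s B \is a fin_num by [].
(* Both [l] and [m] are dominated by [mu], so finite additivity upgrades to countable additivity and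
   [s] is a genuine charge. *)
have ssum : semi_sigma_additive s.
  move=> F mF tF mUF.
  have cl := dominated_sigma_additive l01 lU mF tF.
  have cm : \sum_(0 <= i < n) m (F i) @[n --> \oo] --> m (\bigcup_n F n).
    apply: dominated_sigma_additive => // [A' mA'|A' B' mA' mB'].
      by rewrite pr_ge0 /=.
    exact: prU.
  rewrite (_ : (fun n => _) = EFin \o ((fun n => \sum_(0 <= i < n) l (F i)) \-
      (cst a \* (fun n => \sum_(0 <= i < n) m (F i))))); last first.
    by apply/funext => n /=; rewrite sumEFin sumrB mulr_sumr.
  apply: cvg_EFin; first exact: nearW.
  exact: cvgB cl (cvgM (cvg_cst a) cm).
pose S : {charge set X -> \bar R} :=
  HB.pack s (@isCharge.Build _ X R s s0 sfin ssum).
have /(_ B0 mB0) : forall B, measurable B -> S B = 0%E.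
  apply: (invariant_charge_eq0 f_pmp f_erg e_surj).
  - by move=> g B mB; rewrite /= /s lf// (pr_preimage_action f_pmp).
  - move=> B mB mB0'; have := l01 _ mB.
    by rewrite /= /s /pr mB0' /= mulr0 subr0 => /le_anti <-.
  - by rewrite /= /s lT prT mulr1 subrr.
move=> -[/eqP]; rewrite subr_eq0 => /eqP <-; exact: lcvg.
Qed.

End mixing.

(** * Masses of almost invariant sets *)

Lemma near_all_seq (I : Type) (F : set_system I) (T : eqType) (S : seq T)
    (Q : T -> I -> Prop) : Filter F ->
  (forall s, s \in S -> \forall i \near F, Q s i) ->
  \forall i \near F, forall s, s \in S -> Q s i.
Proof.
move=> FF; elim: S => [|x S IH] h; first by apply: filterE.
have hx := h x (mem_head _ _).
have hS : \forall i \near F, forall s, s \in S -> Q s i.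
  by apply: IH => s sS; apply: h; rewrite in_cons sS orbT.
apply: filterS2 hx hS => i Qx QS s.
by rewrite in_cons => /predU1P[->//|/QS].
Qed.

(** The form with a finite set and an epsilon matches weak containment. For a countable group it
    yields an asymptotically invariant sequence whose masses tend to [a]. *)
Definition almost_invariant_mass (R : realType) (G : groupType) d
    (X : measurableType d) (mu : probability X R) (f : G -> X -> X)
    (a : R) : Prop :=
  forall (S : seq G) (eps : R), 0 < eps ->
  exists A, [/\ measurable A, `|pr mu A - a| < eps &
    forall s, s \in S -> pr mu (f s @^-1` A `\` A) < eps].

Section masses.
Context (R : realType) (G : groupType) d (X : measurableType d).
Context (mu : probability X R) (f : G -> X -> X) (e : nat -> G).
Hypothesis f_pmp : pmp_action mu f.
Hypothesis f_erg : ergodic mu f.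
Hypothesis e_surj : forall g, exists n, e n = g.
Local Notation m := (pr mu).
Local Notation mass := (almost_invariant_mass mu f).

(** Diagonal choice: [A n] is almost invariant, up to [1 / (n + 1)], under the first [n] elements of
    the enumeration, and every fixed element is eventually among them. *)
Lemma mass_sequence a : mass a ->
  exists2 A, asymptotically_invariant mu f A & m (A n) @[n --> \oo] --> a.
Proof.
move=> aV.
have /choice[A AP] n : exists A, [/\ measurable A, `|m A - a| < n.+1%:R^-1 &
    forall s, s \in mkseq e n -> m (f s @^-1` A `\` A) < n.+1%:R^-1].
  by apply: aV; rewrite invr_gt0.
have lim0 : (n.+1%:R^-1 : R) @[n --> \oo] --> 0 by exact: cvg_harmonic.
exists A.
  split=> [n|g]; first by have [] := AP n.
  have [k ek] := e_surj g.
  apply: squeeze_cvgr (@cvg_cst _ _ _ _ _) lim0.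
  near=> n; rewrite pr_ge0/= ltW//; have [_ _] := AP n; apply.
  apply/mapP; exists k; rewrite ?ek// mem_iota/= add0n.
  (* [mkseq e n] ends with [e (n - 1)], so [e k] is listed from [n = k + 1] on. *)
  by near: n; exists k.+1.
apply: cvg_sub0 (@cvg_cst _ _ _ _ _); apply: norm_cvg0.
apply: squeeze_cvgr (@cvg_cst _ _ _ _ _) lim0.
by apply: nearW => n /=; rewrite normr_ge0/= ltW//; have [] := AP n.
Unshelve. all: by end_near. Qed.

Lemma mass0 : mass 0.
Proof.
move=> S eps e0; exists set0; split; rewrite ?pr0 ?subr0 ?normr0// => s _.
by rewrite preimage_set0 setD0 pr0.
Qed.

Lemma massC a : mass a -> mass (1 - a).
Proof.
move=> aV S eps e0; have [A [mA Aa AS]] := aV S eps e0.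
exists (~` A); split; first exact: measurableC.
  by rewrite prC// distrC opprD opprK addrACA subrr add0r addrC.
move=> s sS; rewrite preimage_setC setDE setCK setIC -setDE.
by rewrite (pr_setD_action f_pmp)// AS.
Qed.

Lemma mass_closed a :
  (forall eps, 0 < eps -> exists2 b, mass b & `|b - a| < eps) -> mass a.
Proof.
move=> aV S eps e0; have e20 : 0 < eps / 2 by rewrite divr_gt0.
have [b bV ba] := aV _ e20; have [A [mA Ab AS]] := bV S _ e20.
exists A; split => //; last by move=> s /AS /lt_trans; apply; lra.
apply: le_lt_trans (ler_distD b _ _) _; lra.
Qed.

Lemma mass_itv a : mass a -> 0 <= a <= 1.
Proof.
move=> aV; apply/andP; split; apply/ler_addgt0Pr => eps e0;
  have [A [mA + _]] := aV [::] eps e0; have := pr_ge0 mu A;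
  have := pr_le1 mu mA; rewrite ltr_norml => ? ? /andP[]; lra.
Qed.

(** Fix [A] of mass near [a] and intersect it with a late term of an asymptotically invariant
    sequence for [b]: asymptotic independence makes the masses multiply, and the two invariance
    defects add. *)
Lemma massM a b : mass a -> mass b -> mass (a * b).
Proof.
move=> aV bV S eps e0.
have e20 : 0 < eps / 2 by rewrite divr_gt0.
have [A [mA Aa AS]] := aV S _ e20.
have [B Bi Bb] := mass_sequence bV.
have [mB Bf] := Bi.
have BS : \forall n \near \oo,
    forall s, s \in S -> m (f s @^-1` B n `\` B n) < eps / 2.
  apply: near_all_seq => s _; have /cvgrPdist_lt/(_ _ e20) := Bf s.
  by apply: filterS => n; rewrite sub0r normrN ger0_norm// pr_ge0.
have BA : \forall n \near \oo, `|b * m A - m (B n `&` A)| < eps / 2.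
  exact: (cvgrPdist_lt _ _).1 (cvg_pr_setI f_pmp f_erg e_surj Bi Bb mA) _ e20.
have [n [BnS BnA]] := filter_ex (filterI BS BA).
have mBA : measurable (B n `&` A) by exact: measurableI.
exists (B n `&` A); split => // [|s sS].
  have /andP[b0 b1] := mass_itv bV.
  rewrite (_ : _ - _ = (m (B n `&` A) - b * m A) + b * (m A - a)); last by ring.
  apply: (le_lt_trans (ler_normD _ _)); rewrite distrC normrM (ger0_norm b0).
  have := normr_ge0 (m A - a); nra.
have mfA := measurable_preimage_action f_pmp s mA.
have mfB := measurable_preimage_action f_pmp s (mB n).
have mDA := measurableD mfA mA; have mDB := measurableD mfB (mB n).
apply: (@le_lt_trans _ _ (m (f s @^-1` A `\` A) + m (f s @^-1` B n `\` B n))).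
  apply: le_trans (prU_le mu mDA mDB); apply: pr_le.
  - apply: measurableD => //; rewrite preimage_setI; exact: measurableI.
  - exact: measurableU.
  - move=> x [[Bx Ax] nBA]; have [xA|xA] := pselect (A x); last by left.
    by right; split => // xB; apply: nBA.
by have := AS s sS; have := BnS s sS; lra.
Qed.

Lemma massX a k : mass a -> mass (a ^+ k).
Proof.
move=> aV; elim: k => [|k IH]; last by rewrite exprS; exact: massM.
by rewrite expr0 -[1]subr0; apply: massC; exact: mass0.
Qed.

(** A power of [a] is an arbitrarily small mass [c]. The powers of [1 - c] are masses too, and they
    descend from 1 towards 0 in steps of size at most [c], hence pass close to every [t]. *)
Lemma mass_full a : mass a -> 0 < a < 1 -> forall t, 0 <= t <= 1 -> mass t.
Proof.
move=> aV /andP[a0 a1] t /andP[t0 t1].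
have [->|tn0] := eqVneq t 0; first exact: mass0.
have {tn0}t0 : 0 < t by rewrite lt_neqAle eq_sym tn0.
have Xsmall (b c : R) : 0 < b < 1 -> 0 < c -> exists k, b ^+ k <= c.
  move=> /andP[b0 b1] c0.
  have : b ^+ n @[n --> \oo] --> 0 by apply: cvg_expr; rewrite gtr0_norm.
  move=> /cvgrPdist_lt/(_ _ c0) [k _ /(_ k (leqnn _))] /=.
  by rewrite sub0r normrN => h; exists k; rewrite (le_trans (ler_norm _)) ?ltW.
apply: mass_closed => eps e0.
(* The bound [eps / 2] controls the step size; the bound [1 / 2] keeps [1 - c] strictly between 0
   and 1. *)
have [k ake] : exists k, a ^+ k <= Num.min (eps / 2) (1 / 2).
  by apply: Xsmall; rewrite ?a0// lt_min !divr_gt0.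
pose c := a ^+ k; have c0 : 0 < c by exact: exprn_gt0.
have [c1 c2] : c <= eps / 2 /\ c <= 1 / 2.
  by move: ake; rewrite le_min => /andP[].
have ex : exists n, (1 - c) ^+ n <= t.
  by apply: Xsmall => //; apply/andP; split; lra.
have cV : mass (1 - c) by apply: massC; exact: massX.
(* This is the first power not above [t]: its predecessor exceeds [t] by minimality, and the two
   differ by at most [c]. Exponent 0 is possible only for [t = 1]. *)
exists ((1 - c) ^+ ex_minn ex); first exact: massX.
case: ex_minnP => -[|n] nt nmin.
  by have -> : t = 1; [move: nt; rewrite expr0; lra|rewrite expr0 subrr normr0].
have tn : t < (1 - c) ^+ n by rewrite ltNge; apply/negP => /nmin; rewrite ltnn.
have n1 : (1 - c) ^+ n <= 1 by apply: exprn_ile1; lra.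
rewrite distrC ger0_norm ?subr_ge0//; move: nt; rewrite exprS => nt.
nra.
Qed.

End masses.

(** * Weak containment of the two-point trivial action as mass one half *)

Section weak_containment.
Context (R : realType) (G : groupType) d (X : measurableType d).
Context (mu : probability X R) (f : G -> X -> X).
Hypothesis f_pmp : pmp_action mu f.
Local Notation m := (pr mu).
Local Notation mass := (almost_invariant_mass mu f).
Local Notation half := (bernoulli_prob (2^-1 : R)).

Lemma pr_bernoulli_half (C : set bool) :
  pr half C = 2^-1 * (true \in C)%:R + 2^-1 * (false \in C)%:R.
Proof.
rewrite (_ : pr _ _ = fine (half C))// bernoulli_probE; last first.
  by rewrite invr_ge0 ler0n/= invf_le1 ?ler1n.
rewrite !diracE -!EFinM -EFinD /=; congr (_ + _ * _).
rewrite /unstable.onem. lra.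
Qed.

Lemma weakly_contains_mass :
  weakly_contains mu f half (@trivial_action G bool) -> mass 2^-1.
Proof.
move=> wc S eps e0; have e20 : 0 < eps / 2 by rewrite divr_gt0.
(* A single set is copied, namely [[set true]]. The identity is added to read off the mass of the
   copy; inverses occur because weak containment uses images and masses use preimages. *)
have [A mA AP] := wc 1 (fun=> [set true]) (fun=> I)
  [set` 1%g :: [seq (s^-1)%g | s <- S]] (finite_seq _) _ e20.
pose A0 := A ord0; have mA0 : measurable A0 by exact: mA.
have AS g : g^-1%g \in 1%g :: [seq (s^-1)%g | s <- S] ->
    `|m (f g @^-1` A0 `&` A0) - 2^-1| < eps / 2.
  move=> gS; have := AP ord0 ord0 _ gS.
  have mfA := measurable_preimage_action f_pmp g mA0.
  have mfAA := measurableI _ _ mfA mA0.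
  rewrite (image_action f_pmp) invgK -/A0 image_id setIid -!prE//.
  rewrite -EFinB /abse lte_fin pr_bernoulli_half.
  by rewrite mem_set// memNset// mulr1 mulr0 addr0.
have h1 : `|m A0 - 2^-1| < eps / 2.
  have := AS 1%g; rewrite invg1 mem_head => /(_ isT).
  by rewrite (_ : f 1%g @^-1` A0 = A0) ?setIid//;
    apply/seteqP; split => x /=; rewrite (pmp_act1 f_pmp).
exists A0; split => //; first lra.
move=> s sS; have := AS s; rewrite in_cons map_f ?orbT// => /(_ isT).
have mfA := measurable_preimage_action f_pmp s mA0.
have := prDI mu mfA mA0; rewrite (pr_preimage_action f_pmp)//.
move: h1; rewrite !ltr_norml => /andP[? ?] ? /andP[? ?]; lra.
Qed.

(** The indicator of one almost invariant set of mass near 1/2 serves as an almost equivariant map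
    to [bool], through which all the sets [B i] are pulled back. *)
Lemma mass_weakly_contains :
  mass 2^-1 -> weakly_contains mu f half (@trivial_action G bool).
Proof.
move=> hV n B mB S /finite_seqP[t ->] eps e0.
(* Three quarters of [eps] get spent: two through the factor 2 in [dist_pr_action], one on the mass
   of the pulled back intersection. *)
have e40 : 0 < eps / 4 by rewrite divr_gt0.
have [A [mA Aa AS]] := hV [seq (s^-1)%g | s <- t] _ e40.
pose c C := [set x | C (x \in A)] : set X.
have mAC := measurableC mA.
have cE C : [\/ C = [set true] /\ c C = A, C = [set false] /\ c C = ~` A,
    C = set0 /\ c C = set0 | C = setT /\ c C = setT].
  have [/eqP C0|/eqP C0|/eqP C0|/eqP C0] := set_bool C.
  - apply: Or41; split => //; apply/seteqP.
    by split => x; rewrite /c C0 /=; [exact: set_mem|exact: mem_set].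
  - apply: Or42; split => //; apply/seteqP; rewrite /c C0.
    split => x /=; first by move/negbT; rewrite notin_setE.
    by move=> xA; rewrite memNset.
  - by apply: Or43; split => //; rewrite /c C0.
  - by apply: Or44; split => //; rewrite /c C0.
have mc C : measurable (c C) by have [[_ ->]|[_ ->]|[_ ->]|[_ ->]] := cE C.
have cI C D : c C `&` c D = c (C `&` D) by [].
have mcE C : `|m (c C) - pr half C| < eps / 4.
  rewrite pr_bernoulli_half; have [[-> ->]|[-> ->]|[-> ->]|[-> ->]] := cE C.
  - by rewrite mem_set// memNset// mulr1 mulr0 addr0.
  - rewrite memNset// mem_set// mulr1 mulr0 add0r prC//.
    by rewrite (_ : 1 - m A - 2^-1 = - (m A - 2^-1)) ?normrN//; lra.
  - by rewrite !memNset// !mulr0 pr0 addr0 subrr normr0.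
  - by rewrite !mem_set// !mulr1 prT (_ : _ - _ = 0) ?normr0//; lra.
have cS C s : s \in t -> m (f s^-1%g @^-1` c C `\` c C) < eps / 4.
  move=> st; have := AS _ (map_f _ st).
  have [[_ ->]//|[_ ->]|[_ ->]|[_ ->]] := cE C.
  - rewrite -(pr_setD_action f_pmp _ mA) preimage_setC.
    by rewrite (_ : _ `\` ~` A = A `\` f s^-1%g @^-1` A)// !setDE setCK setIC.
  - by rewrite preimage_set0 setD0 pr0.
  - by rewrite preimage_setT setDv pr0.
exists (fun i => c (B i)); first by move=> i; exact: mc.
move=> i j s st; have mI C D : measurable (c C `&` c D) by exact: measurableI.
have mf := measurable_preimage_action f_pmp s^-1%g (mc (B i)).
have mfI := measurableI _ _ mf (mc (B j)).
rewrite (image_action f_pmp) image_id -!prE// -EFinB /abse lte_fin.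
have h1 := dist_pr_action f_pmp s^-1%g (mc (B j)) (mc (B i)).
rewrite setIC (setIC (B i)).
have h2 := mcE (B j `&` B i); rewrite -cI in h2.
have h3 := cS (B j) s st.
apply: (le_lt_trans (ler_distD (m (c (B j) `&` c (B i))) _ _)).
lra.
Qed.

End weak_containment.

(** * Integrals of bounded measurable functions *)

Definition bounded_measurable d (T : measurableType d) (R : realType)
    (u : T -> R) : Prop :=
  measurable_fun [set: T] u /\ exists M : R, forall x, `|u x| <= M.

Section bounded_measurable_lemmas.
Context d (T : measurableType d) (R : realType) (P : probability T R).
Implicit Types u v w : T -> R.
Local Notation bm := (@bounded_measurable d T R).

Lemma bm_integrable u : bm u -> P.-integrable setT (EFin \o u).
Proof.
move=> [mu [M uM]]; apply: measurable_bounded_integrable => //.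
  by rewrite (le_lt_trans (probability_le1 P measurableT))// ltry.
exists M; split; first exact: num_real.
by move=> r Mr x _ /=; rewrite (le_trans (uM x))// ltW.
Qed.

Lemma bm_cst r : bm (cst r).
Proof. by split; [exact: measurable_cst|exists `|r|]. Qed.

Lemma bmD u v : bm u -> bm v -> bm (fun x => u x + v x).
Proof.
move=> [mu [M uM]] [mv [N vN]]; split; first exact: measurable_funD.
by exists (M + N) => x; rewrite (le_trans (ler_normD _ _))// lerD.
Qed.

Lemma bmM u v : bm u -> bm v -> bm (fun x => u x * v x).
Proof.
move=> [mu [M uM]] [mv [N vN]]; split; first exact: measurable_funM.
by exists (M * N) => x; rewrite normrM ler_pM.
Qed.

Lemma bmZ r u : bm u -> bm (fun x => r * u x).
Proof. by move=> bu; apply: bmM => //; exact: bm_cst. Qed.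

Lemma bmN u : bm u -> bm (fun x => - u x).
Proof.
move=> [mu [M uM]]; split; first exact: measurableT_comp.
by exists M => x; rewrite normrN.
Qed.

Lemma bmB u v : bm u -> bm v -> bm (fun x => u x - v x).
Proof. by move=> bu bv; apply: bmD => //; exact: bmN. Qed.

Lemma bm_norm u : bm u -> bm (fun x => `|u x|).
Proof.
move=> [mu [M uM]]; split; first exact: measurableT_comp.
by exists M => x; rewrite normr_id.
Qed.

Lemma bm_indic A : measurable A -> bm \1_A.
Proof.
move=> mA; split; first exact: measurable_indic.
by exists 1 => x; rewrite indicE; case: (_ \in _); rewrite ?normr1 ?normr0.
Qed.

Lemma Rintegral_indic A : measurable A -> \int[P]_x \1_A x = pr P A.
Proof. by move=> mA; rewrite /Rintegral integral_indic// setIT. Qed.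

Lemma Rintegral_prob_cst r : \int[P]_x r = r.
Proof. by rewrite Rintegral_cst// [fine _](prT P) mulr1. Qed.

Lemma bm_Rintegral_le u v : bm u -> bm v -> (forall x, u x <= v x) ->
  \int[P]_x u x <= \int[P]_x v x.
Proof. by move=> bu bv uv; apply: le_Rintegral => //; exact: bm_integrable. Qed.

Lemma bm_RintegralD u v : bm u -> bm v ->
  \int[P]_x (u x + v x) = \int[P]_x u x + \int[P]_x v x.
Proof. by move=> bu bv; rewrite RintegralD//; exact: bm_integrable. Qed.

Lemma bm_RintegralB u v : bm u -> bm v ->
  \int[P]_x (u x - v x) = \int[P]_x u x - \int[P]_x v x.
Proof. by move=> bu bv; rewrite RintegralB//; exact: bm_integrable. Qed.

Lemma bm_RintegralZ r u : bm u -> \int[P]_x (r * u x) = r * \int[P]_x u x.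
Proof. by move=> bu; rewrite RintegralZl//; exact: bm_integrable. Qed.

Lemma bm_dist_Rintegral u v w : bm u -> bm v -> bm w ->
  (forall x, `|u x - v x| <= w x) ->
  `|\int[P]_x u x - \int[P]_x v x| <= \int[P]_x w x.
Proof.
move=> bu bv bw uvw; rewrite -bm_RintegralB//.
apply: le_trans (le_normr_Rintegral _ (bm_integrable (bmB bu bv))) _ => //.
by apply: bm_Rintegral_le => //; apply: bm_norm; exact: bmB.
Qed.

End bounded_measurable_lemmas.

(** Subtracting a multiple of the indicator of a superlevel set halves the range of a function.
    Iterating approximates it uniformly by linear combinations of indicators. *)
Lemma bounded_measurable_ind d (T : measurableType d) (R : realType)
    (C : (T -> R) -> Prop) :
  (forall A, measurable A -> C \1_A) ->
  (forall r u v, C u -> C v -> C (fun x => r * u x + v x)) ->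
  (forall u, bounded_measurable u ->
    (forall e, 0 < e -> exists2 g, C g & forall x, `|u x - g x| <= e) -> C u) ->
  forall u, bounded_measurable u -> C u.
Proof.
move=> C1 CD Cu.
have C0 : C (cst 0).
  by have := C1 _ (@measurable0 _ T); rewrite indic0.
(* halving: [u - (c / 2) 1_{u >= c / 2}] takes values in [0, c / 2] *)
have halve k : forall c u, 0 <= c -> bounded_measurable u ->
    (forall x, 0 <= u x <= c) ->
    exists2 g, C g & forall x, `|u x - g x| <= c / 2 ^+ k.
  elim: k => [|k IH] c u c0 bu u0c.
    exists (cst 0) => // x; rewrite subr0 expr0 divr1.
    by have /andP[u0 uc] := u0c x; rewrite ger0_norm.
  pose A := u @^-1` `[c / 2, +oo[.
  have mA : measurable A.
    by rewrite /A -[X in measurable X]setTI; apply: (proj1 bu).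
  have [||x|g Cg gP] := IH (c / 2) (fun x => u x - c / 2 * \1_A x).
  - by rewrite divr_ge0.
  - by apply: bmB => //; apply: bmZ; exact: bm_indic.
  - have /andP[u0 uc] := u0c x; rewrite indicE.
    have [|] := boolP (x \in A).
      by rewrite inE /A /= in_itv/= andbT; lra.
    by rewrite notin_setE /A /= in_itv/= andbT => /negP; rewrite -ltNge; lra.
  exists (fun x => c / 2 * \1_A x + g x); first by apply: CD => //; exact: C1.
  move=> x; rewrite opprD addrA (le_trans (gP x))// exprS invfM mulrA//.
move=> u bu; apply: Cu => // e e0; have [mu [M uM]] := bu.
have M0 : 0 <= M by rewrite (le_trans _ (uM point)).
have [k ke] : exists k, 2 * M / 2 ^+ k <= e.
  have : (2^-1 : R) ^+ n @[n --> \oo] --> 0.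
    by apply: cvg_expr; rewrite gtr0_norm ?invf_lt1 ?ltr1n.
  (* The summand 1 keeps the divisor positive when [M = 0]. *)
  have e10 : 0 < e / (2 * M + 1) by rewrite divr_gt0//; lra.
  move=> /cvgrPdist_lt/(_ _ e10) [k _ /(_ k (leqnn _))] /=.
  rewrite sub0r normrN ger0_norm ?exprn_ge0// => h.
  exists k; rewrite -exprVn; move: h; rewrite ltr_pdivlMr; last lra.
  have : 0 < 2^-1 ^+ k :> R by rewrite exprn_gt0.
  nra.
(* Adding [M] moves the values into the interval from 0 to [2 * M]; the shift is undone below by a
   multiple of the indicator of the whole space. *)
have [||x|g Cg gP] := halve k (2 * M) (fun x => u x + M).
- lra.
- by apply: bmD => //; exact: bm_cst.
- by have := uM x; rewrite ler_norml => /andP[]; lra.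
exists (fun x => - M * \1_setT x + g x); first by apply: CD => //; exact: C1.
move=> x; rewrite indicT mulr1 opprD opprK addrA; exact: le_trans (gP x) ke.
Qed.

(** * The configuration space *)

Section integral_mixing.
Context (R : realType) (G : groupType) d (X : measurableType d).
Context (mu : probability X R) (f : G -> X -> X) (e : nat -> G).
Hypothesis f_pmp : pmp_action mu f.
Hypothesis f_erg : ergodic mu f.
Hypothesis e_surj : forall g, exists n, e n = g.

(** Asymptotic independence for indicators extends to bounded functions by linearity and uniform
    approximation, as multiplying by an indicator does not increase a uniform error. *)
Lemma cvg_Rintegral_indic (A : nat -> set X) (a : R) (u : X -> R) :
  asymptotically_invariant mu f A -> pr mu (A n) @[n --> \oo] --> a ->
  bounded_measurable u ->
  \int[mu]_x (\1_(A n) x * u x) @[n --> \oo] --> a * \int[mu]_x u x.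
Proof.
move=> Ai Aa; have [mA _] := Ai.
have bA n : bounded_measurable (\1_(A n) : X -> R) by exact: bm_indic.
move=> bu; suff [] : bounded_measurable u /\
  \int[mu]_x (\1_(A n) x * u x) @[n --> \oo] --> a * \int[mu]_x u x by [].
elim/bounded_measurable_ind : bu => {u}[B mB|r u v [bu uc] [bv vc]|u bu uP].
- split; first exact: bm_indic.
  rewrite Rintegral_indic//.
  under eq_fun => n.
    under eq_Rintegral => x _ do rewrite -[_ * _]/((\1_(A n) \* \1_B) x) -indicI.
    rewrite Rintegral_indic; last exact: measurableI.
    over.
  exact: (cvg_pr_setI f_pmp f_erg e_surj Ai Aa).
- have bru := bmZ r bu; split; first exact: bmD.
  have bAu n := bmM (bA n) bu; have bAv n := bmM (bA n) bv.
  rewrite bm_RintegralD// bm_RintegralZ//.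
  under eq_fun => n.
    rewrite (_ : \int[mu]_x _ = r * \int[mu]_x (\1_(A n) x * u x) +
      \int[mu]_x (\1_(A n) x * v x)); last first.
      rewrite -bm_RintegralZ// -bm_RintegralD//; last exact: bmZ.
      by apply: eq_Rintegral => x _; ring.
    over.
  rewrite mulrDr mulrCA; apply: cvgD => //.
  by apply: cvgM => //; exact: cvg_cst.
split=> //; apply/cvgrPdist_le => eps e0.
(* The term with [a] pays for replacing [u] by [g] in the limit; the 2 pays for the convergence for
   [g] and for going back to [u] in the integral over [A n]. *)
pose c := 2 + `|a|; have c0 : 0 < c by rewrite ltr_pwDl.
have ec0 : 0 < eps / c by rewrite divr_gt0.
have [g [bg gc] gu] := uP _ ec0.
have ug : `|\int[mu]_x u x - \int[mu]_x g x| <= eps / c.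
  rewrite -[leRHS](Rintegral_prob_cst mu).
  by apply: bm_dist_Rintegral => //; exact: bm_cst.
move/cvgrPdist_le : gc => /(_ _ ec0); apply: filterS => n gn.
have ugn : `|\int[mu]_x (\1_(A n) x * g x) - \int[mu]_x (\1_(A n) x * u x)| <= eps / c.
  rewrite -[leRHS](Rintegral_prob_cst mu).
  apply: bm_dist_Rintegral; do ?exact: bmM; first exact: bm_cst.
  move=> x; rewrite -mulrBr normrM distrC indicE.
  by case: (_ \in _); rewrite ?normr1 ?normr0 ?mul1r ?mul0r// ltW.
apply: (le_trans (ler_distD (a * \int[mu]_x g x) _ _)).
rewrite -mulrBr normrM; apply: (@le_trans _ _ (`|a| * (eps / c) + (eps / c + eps / c))).
  apply: lerD; first exact: ler_wpM2l.
  by apply: (le_trans (ler_distD (\int[mu]_x (\1_(A n) x * g x)) _ _)); exact: lerD.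
have -> : `|a| * (eps / c) + (eps / c + eps / c) = c * (eps / c) by rewrite /c; ring.
by rewrite mulrC divfK// gt_eqF.
Qed.

End integral_mixing.

Lemma ptws_cvg (I : Type) (K : topologicalType) (T : Type) (F : set_system T)
    (u : T -> {ptws I -> K}) (l : {ptws I -> K}) : Filter F ->
  (forall i, u x i @[x --> F] --> l i) -> u @ F --> l.
Proof.
move=> FF h U; rewrite nbhsE => -[_ [[B sB <-] [C BC Cw]] BU].
have [D sD DC] := sB _ BC.
have FC : F (u @^-1` C).
  rewrite -DC preimage_bigcap; apply: filter_bigI => E ED.
  have /sD := ED; move=> /set_mem[i _ [V oV VE]].
  have : nbhs (l i) V.
    apply: open_nbhs_nbhs; split => //.
    by move: Cw; rewrite -DC => /(_ _ ED); rewrite -VE.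
  by move=> /(h i); rewrite -VE.
by apply: filterS FC => x /= Cx; apply: BU; exists C.
Qed.

Section config_space.
Context (R : realType) (G : groupType) (K : ptopologicalType).
Hypothesis K_compact : compact [set: K].
Local Notation KG := (baireConfig R G K).

Lemma compact_config : compact [set: config G K].
Proof.
have := @tychonoff {classic G} (fun=> K) (fun=> setT) (fun=> K_compact).
by congr compact; apply/seteqP; split.
Qed.

Lemma continuous_bounded_measurable (h : config G K -> R) :
  continuous h -> bounded_measurable (h : KG -> R).
Proof.
move=> ch; split.
  apply: (measurability _ (RGenOpens.measurableE R)) => //.
  move=> _ [_ [a [b ->]] <-]; rewrite setTI; apply: sub_sigma_algebra.
  by exists h, `]a, b[%classic; split => //; exact: interval_open.
have : compact (h @` setT).
  by apply: continuous_compact compact_config; exact: continuous_subspaceT.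
move=> /compact_bounded[M [_ hM]]; exists (M + 1) => w.
by apply: hM; [rewrite ltrDl|exists w].
Qed.

Lemma shift_continuous (g : G) : continuous (Defs.shift g : config G K -> config G K).
Proof.
move=> w; apply: ptws_cvg => i.
exact: (@proj_continuous {classic G} (fun=> K) (i * g)%g w).
Qed.

Lemma measurable_continuous_config (T : config G K -> config G K) :
  continuous T -> measurable_fun [set: KG] (T : KG -> KG).
Proof.
move=> cT; apply: (@measurability _ _ _ KG setT _ (baire_generators R (config G K)) erefl) => //.
move=> _ [_ [h [U [ch oU ->]]] <-]; rewrite setTI; apply: sub_sigma_algebra.
exists (h \o T), U; split => // w.
by apply: continuous_comp; [exact: cT|exact: ch].
Qed.

(** A basic open set of the product is a finite intersection of cylinders; [S] collects their
    coordinates. *)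
Lemma nbhs_config (w : config G K) (U : set (config G K)) : nbhs w U ->
  exists V (S : seq G), [/\ open V, V w, V `<=` U & forall w1 w2 : config G K,
    (forall s, s \in S -> w1 s = w2 s) -> V w1 -> V w2].
Proof.
rewrite nbhsE => -[_ [[B sB <-] [C BC Cw]] BU].
have [D sD DC] := sB _ BC; exists C.
(* Each subbasic set constrains one coordinate [g E]; the value [1%g] for other sets is only a
   filler. *)
have /choice[g gP] E : exists g : G, E \in D ->
    exists V, E = (fun w : config G K => w g) @^-1` V.
  have [/sD/set_mem[g _ [V _ <-]]|//] := boolP (E \in D); last by exists 1%g.
  by exists g => _; exists V.
exists (map g (enum_fset D)); split => //.
- by exists [set C]; [move=> _ ->; exact: sB|rewrite bigcup_set1].
- by move=> x Cx; apply: BU; exists C.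
- move=> w1 w2 w12; rewrite -DC => Cw1 E /= ED.
  have [V EV] := gP _ ED; have := Cw1 _ ED; rewrite {}EV /= w12//.
  exact: map_f.
Qed.

(** By compactness finitely many neighbourhoods, each depending on finitely many coordinates, cover
    the space, and [h] stays within [eps / 2] of its central value on each. Configurations that
    agree on all these coordinates share such a neighbourhood. *)
Lemma continuous_finite_coordinates (h : config G K -> R) (eps : R) :
  continuous h -> 0 < eps -> exists S : seq G, forall w1 w2 : config G K,
    (forall s, s \in S -> w1 s = w2 s) -> `|h w1 - h w2| <= eps.
Proof.
move=> ch e0; have e20 : 0 < eps / 2 by rewrite divr_gt0.
have H w : exists VS : set (config G K) * seq G, [/\ open VS.1, VS.1 w,
    VS.1 `<=` [set w1 | `|h w - h w1| < eps / 2] & forall w1 w2 : config G K,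
    (forall s, s \in VS.2 -> w1 s = w2 s) -> VS.1 w1 -> VS.1 w2].
  have /nbhs_config[V [S ?]] : nbhs w [set w1 | `|h w - h w1| < eps / 2].
    by have /cvgrPdist_lt := ch w; apply.
  by exists (V, S).
have {H}[W WP] := choice H.
have := compact_config; rewrite compact_cover => /(_ _ setT (fun w => (W w).1)).
case=> [w _|w _|D _ cov]; first by have [] := WP w.
  by exists w => //; have [] := WP w.
exists (flatten [seq (W w).2 | w <- enum_fset D]) => w1 w2 w12.
have [w wD Vw1] := cov w1 I.
have [_ _ Ve VS] := WP w.
have Vw2 : (W w).1 w2.
  apply: VS Vw1 => s sS; apply: w12; apply/flattenP.
  by exists (W w).2 => //; apply/mapP; exists w.
have := Ve _ Vw1; have := Ve _ Vw2; rewrite /= => h1 h2.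
by rewrite (le_trans (ler_distD (h w) _ _))// (distrC (h w1)); lra.
Qed.

Lemma Rintegral_pushforward d (X : measurableType d) (mu : probability X R)
    (Phi : X -> KG) (nu : probability KG R) (h : KG -> R) :
  measurable_fun setT Phi ->
  (forall A, measurable A -> nu A = pushforward mu Phi A) ->
  bounded_measurable h -> \int[nu]_w h w = \int[mu]_x h (Phi x).
Proof.
move=> mPhi nuE bh; have [mh [M hM]] := bh.
have bhP : bounded_measurable (h \o Phi).
  by split; [exact: (measurableT_comp mh mPhi)|exists M => x /=].
rewrite /Rintegral; congr fine.
rewrite (eq_measure_integral (pushforward mu Phi)); last by move=> A mA _; exact: nuE.
rewrite integral_pushforward//; first exact/measurable_EFinP.
exact: (bm_integrable mu bhP).
Qed.

End config_space.

(** * Gluing two factor maps *)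

Lemma Rintegral_mixture d (T : measurableType d) (R : realType) (t : {i01 R})
    (m1 m2 : probability T R) (u : T -> R) : bounded_measurable u ->
  \int[mixture t m1 m2]_x u x =
  t%:num * \int[m1]_x u x + (1 - t%:num) * \int[m2]_x u x.
Proof.
have t01 : (0 <= t%:num :> R) && (t%:num <= 1 :> R) by apply/andP.
move=> bu; suff [] : bounded_measurable u /\ \int[mixture t m1 m2]_x u x =
  t%:num * \int[m1]_x u x + (1 - t%:num) * \int[m2]_x u x by [].
elim/bounded_measurable_ind : bu => {u}[B mB|r u v [bu uE] [bv vE]|u bu uP].
- split; first exact: bm_indic.
  rewrite !Rintegral_indic//; apply: EFin_inj.
  rewrite EFinD !EFinM !prE//; exact: mixtureE.
- have bru := bmZ r bu; split; first exact: bmD.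
  by rewrite !bm_RintegralD// !bm_RintegralZ// uE vE; ring.
split=> //; apply/eqP; rewrite -subr_eq0 -normr_le0; apply/ler_addgt0Pr => e e0.
have e20 : 0 < e / 2 by rewrite divr_gt0.
have [g [bg gE] ug] := uP _ e20.
have gu (P : probability T R) : `|\int[P]_x u x - \int[P]_x g x| <= e / 2.
  rewrite -[leRHS](Rintegral_prob_cst P).
  by apply: bm_dist_Rintegral => //; exact: bm_cst.
(* The weights [t] and [1 - t] sum to 1, so each side is within [e / 2] of the common value obtained
   from [g]. *)
have := gu (mixture t m1 m2); have := gu m1; have := gu m2; rewrite gE !ler_norml.
move: t01 => /andP[t0 t1] /andP[? ?] /andP[? ?] /andP[? ?].
by apply/andP; split; nra.
Qed.

Section gluing.
Context (R : realType) (G : groupType) d (X : measurableType d).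
Context (mu : probability X R) (f : G -> X -> X) (e : nat -> G).
Hypothesis f_pmp : pmp_action mu f.
Hypothesis f_erg : ergodic mu f.
Hypothesis e_surj : forall g, exists n, e n = g.
Context (K : ptopologicalType).
Hypothesis K_compact : compact [set: K].
Local Notation KG := (baireConfig R G K).
Local Notation borel := (g_sigma_algebraType (@open K)).
Local Notation m := (pr mu).

Lemma factor_measure_exists (phi : X -> K) :
  measurable_fun [set: X] (phi : X -> borel) ->
  exists nu : probability KG R,
    forall A, nu A = pushforward mu (equivariant_map f phi : X -> KG) A.
Proof.
move=> mphi.
have mPhi := @measurable_equivariant_map R G K d X f phi K_compact
  (pmp_measurable f_pmp) mphi.
pose Phi : {mfun X >-> KG} :=
  HB.pack (equivariant_map f phi : X -> KG) (isMeasurableFun.Build _ _ _ _ _ mPhi).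
by exists (distribution mu Phi).
Qed.

Lemma cvg_pr_bigsetU (D : nat -> G -> set X) (S : seq G) :
  (forall n s, measurable (D n s)) ->
  (forall s, m (D n s) @[n --> \oo] --> 0) ->
  m (\big[setU/set0]_(s <- S) D n s) @[n --> \oo] --> 0.
Proof.
move=> mD D0; elim: S => [|s S IH].
  by under eq_fun do rewrite big_nil pr0; exact: cvg_cst.
have h : m (D n s) + m (\big[setU/set0]_(s <- S) D n s) @[n --> \oo] --> 0.
  by rewrite -(addr0 0); exact: cvgD.
apply: squeeze_cvgr (@cvg_cst _ _ _ _ _) h; apply: nearW => n.
rewrite pr_ge0/= big_cons prU_le//.
by apply: bigsetU_measurable => i _.
Qed.

Definition glue (phi1 phi2 : X -> K) (A : set X) (x : X) : K :=
  if x \in A then phi1 x else phi2 x.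

Lemma measurable_glue (phi1 phi2 : X -> K) (A : set X) : measurable A ->
  measurable_fun [set: X] (phi1 : X -> borel) ->
  measurable_fun [set: X] (phi2 : X -> borel) ->
  measurable_fun [set: X] (glue phi1 phi2 A : X -> borel).
Proof.
move=> mA m1 m2 _ B mB; rewrite setTI.
have -> : glue phi1 phi2 A @^-1` B =
    (A `&` phi1 @^-1` B) `|` (~` A `&` phi2 @^-1` B).
  apply/seteqP; rewrite /glue; split => x /=.
    by have [/set_mem|/negP] := boolP (x \in A); [left|right; split => // /mem_set].
  by move=> [[xA]|[xA]]; [rewrite mem_set|rewrite memNset].
apply: measurableU; apply: measurableI => //; first last.
- by rewrite -[X in measurable X]setTI; exact: m2.
- exact: measurableC.
- by rewrite -[X in measurable X]setTI; exact: m1.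
Qed.

(** Up to a small error [h] reads only the coordinates in a finite set [S]. Unless some element of
    [S] moves [x] across the boundary of [A n], these coordinates of the glued configuration all
    come from the same map. *)
Lemma cvg_Rintegral_glue (A : nat -> set X) (t : R) (phi1 phi2 : X -> K)
    (h : config G K -> R) :
  asymptotically_invariant mu f A -> m (A n) @[n --> \oo] --> t ->
  measurable_fun [set: X] (phi1 : X -> borel) ->
  measurable_fun [set: X] (phi2 : X -> borel) -> continuous h ->
  \int[mu]_x h (equivariant_map f (glue phi1 phi2 (A n)) x) @[n --> \oo] -->
  t * \int[mu]_x h (equivariant_map f phi1 x) +
  (1 - t) * \int[mu]_x h (equivariant_map f phi2 x).
Proof.
move=> Ai At mphi1 mphi2 ch; have [mA Af] := Ai.
have [mh [M hM]] := continuous_bounded_measurable K_compact ch.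
have bu phi : measurable_fun [set: X] (phi : X -> borel) ->
    bounded_measurable (fun x => h (equivariant_map f phi x)).
  move=> mphi; split; last by exists M => x.
  have mPhi := @measurable_equivariant_map R G K d X f phi K_compact
    (pmp_measurable f_pmp) mphi.
  rewrite -[X in measurable_fun _ X]/((h : KG -> R) \o (equivariant_map f phi : X -> KG)).
  exact: (measurableT_comp mh mPhi).
pose u1 x := h (equivariant_map f phi1 x).
pose u2 x := h (equivariant_map f phi2 x).
have bu1 : bounded_measurable u1 by exact: bu.
have bu2 : bounded_measurable u2 by exact: bu.
(* [J n] is the integral of the function equal to [u1] on [A n] and to [u2] off it. *)
pose J n := \int[mu]_x (\1_(A n) x * u1 x) +
  (\int[mu]_x u2 x - \int[mu]_x (\1_(A n) x * u2 x)).
have cJ : J n @[n --> \oo] --> t * \int[mu]_x u1 x +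
    (1 - t) * \int[mu]_x u2 x.
  rewrite mulrBl mul1r; apply: cvgD.
    exact: (cvg_Rintegral_indic f_pmp f_erg e_surj Ai At).
  apply: cvgB; first exact: cvg_cst.
  exact: (cvg_Rintegral_indic f_pmp f_erg e_surj Ai At).
apply/cvgrPdist_le => eps e0.
have e30 : 0 < eps / 3 by rewrite divr_gt0.
have [S SP] := continuous_finite_coordinates K_compact ch e30.
(* The points that [s] moves into or out of [A n]; [Bad n] collects them over [S]. *)
pose D n s := (f s @^-1` A n `\` A n) `|` (A n `\` f s @^-1` A n).
have mfA n s : measurable (f s @^-1` A n).
  exact: (measurable_preimage_action f_pmp).
have mD n s : measurable (D n s) by apply: measurableU; exact: measurableD.
pose Bad n := \big[setU/set0]_(s <- S) D n s.
have mBad n : measurable (Bad n) by apply: bigsetU_measurable => i _.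
have Bad0 : m (Bad n) @[n --> \oo] --> 0.
  apply: cvg_pr_bigsetU => // s.
  have h2 : m (f s @^-1` A n `\` A n) + m (f s @^-1` A n `\` A n) @[n --> \oo] --> 0.
    by rewrite -(addr0 0); apply: cvgD; exact: Af.
  apply: squeeze_cvgr (@cvg_cst _ _ _ _ _) h2; apply: nearW => n.
  rewrite pr_ge0/= -[in X in _ + X](pr_setD_action f_pmp)// prU_le//;
    exact: measurableD.
have M0 : 0 <= M by rewrite (le_trans _ (hM point)).
pose c := 2 * M + 1; have c0 : 0 < c by rewrite /c; lra.
have ec0 : 0 < eps / 3 / c by rewrite divr_gt0.
have Bade : \forall n \near \oo, m (Bad n) < eps / 3 / c.
  have /cvgrPdist_lt/(_ _ ec0) := Bad0.
  by apply: filterS => n; rewrite sub0r normrN ger0_norm// pr_ge0.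
move/cvgrPdist_le : cJ => /(_ _ e30); apply: filterS2 Bade => n Bn Jn.
pose un x := h (equivariant_map f (glue phi1 phi2 (A n)) x).
have bun : bounded_measurable un by apply: bu; exact: measurable_glue.
have bA : bounded_measurable (\1_(A n) : X -> R) by exact: bm_indic.
have bA1 := bmM bA bu1; have bA2 := bmM bA bu2.
(* The integrands differ by at most [2 * M] on [Bad n], and by at most [eps / 3] elsewhere by the
   choice of [S]. *)
have unJ : `|\int[mu]_x un x - J n| <= eps / 3 + 2 * M * m (Bad n).
  rewrite /J -bm_RintegralB// -bm_RintegralD//; last exact: bmB.
  rewrite -[X in _ <= X + _](Rintegral_prob_cst mu) -Rintegral_indic//.
  have b1 : bounded_measurable (\1_(Bad n) : X -> R) by exact: bm_indic.
  rewrite -bm_RintegralZ// -bm_RintegralD//; [|exact: bm_cst|exact: bmZ].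
  apply: bm_dist_Rintegral => //.
  - by apply: bmD => //; exact: bmB.
  - by apply: bmD; [exact: bm_cst|exact: bmZ].
  move=> x; rewrite [\1_(Bad n) x]indicE; have [xB|xB] := boolP (x \in Bad n).
    have := hM (equivariant_map f (glue phi1 phi2 (A n)) x).
    have := hM (equivariant_map f phi1 x); have := hM (equivariant_map f phi2 x).
    rewrite -/(un x) -/(u1 x) -/(u2 x) indicE !ler_norml.
    by case: (_ \in _) => /andP[? ?] /andP[? ?] /andP[? ?]; apply/andP; split;
      rewrite /= ?mul1r ?mul0r ?mulr1; lra.
  have xD s : s \in S -> ~ D n s x.
    move=> sS Dx; move/negP : xB; apply; apply/mem_set.
    by rewrite /Bad -bigcup_seq; exists s.
  rewrite mulr0 addr0 indicE; have [xA|xA] := boolP (x \in A n).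
    rewrite !mul1r subrr addr0; apply: SP => s sS.
    rewrite /equivariant_map /glue mem_set//; apply: contrapT => fA.
    by apply: (xD s sS); right; split => //; exact: set_mem.
  rewrite !mul0r add0r subr0; apply: SP => s sS.
  rewrite /equivariant_map /glue memNset// => fA.
  by apply: (xD s sS); left; split => //; move: xA; rewrite notin_setE.
apply: (le_trans (ler_distD (J n) _ _)).
rewrite (distrC (J n)).
have Mm : 2 * M * m (Bad n) <= eps / 3.
  apply: (@le_trans _ _ (c * (eps / 3 / c))); last by rewrite mulrC divfK// gt_eqF.
  have c2 : 2 * M <= c by rewrite /c; lra.
  have M20 : 0 <= 2 * M by lra.
  exact: ler_pM M20 (pr_ge0 _ _) c2 (ltW Bn).
by have := lerD Jn unJ; move: Mm; lra.
Qed.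

End gluing.

(** * Mixtures and the weak* closure *)

Lemma initial_cvg (S : choiceType) (T : topologicalType) (g : S -> T)
    (I : Type) (F : set_system I) (u : I -> S) (l : S) : Filter F ->
  g (u i) @[i --> F] --> g l -> u @ F --> (l : initial_topology g).
Proof.
move=> FF h A /= [_ [[B Bop <-] Bl BA]].
have gB : nbhs (g l) B by exact: open_nbhs_nbhs.
have FB : F [set i | B (g (u i))] := h B gB.
change (F (u @^-1` A)); apply: filterS FB => i /= Bi; exact: BA.
Qed.

Section weakstar.
Context (R : realType) (G : groupType) (K : ptopologicalType).
Hypothesis K_compact : compact [set: K].
Local Notation KG := (baireConfig R G K).
Local Notation weak := (weakstar R G K).
Implicit Types nu : probability KG R.

Lemma weakstar_cvg (I : Type) (F : set_system I) (u : I -> probability KG R) nu :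
  Filter F ->
  (forall h : config G K -> R, continuous h ->
    \int[u i]_w h w @[i --> F] --> \int[nu]_w h w) ->
  u @ F --> (nu : weak).
Proof.
move=> FF h; apply: initial_cvg; apply: ptws_cvg => -[k ck] /=.
exact: h.
Qed.

Lemma weakstar_integral (h : config G K -> R) : continuous h ->
  continuous ((fun nu => \int[nu]_w h w) : weak -> R).
Proof.
move=> ch nu.
pose i : {classic {h : config G K -> R | continuous h}} := exist _ h ch.
apply: (@cvg_comp _ _ _ (@integrals R G K : weak -> _) (fun g => g i)).
  exact: initial_continuous.
exact: (@proj_continuous {classic {h : config G K -> R | continuous h}}
  (fun=> R) i).
Qed.

Lemma mixture_continuousl (t : {i01 R}) nu2 :
  continuous (fun nu1 : weak => mixture t nu1 nu2 : weak).
Proof.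
move=> nu1; apply: (@weakstar_cvg weak (nbhs nu1) _ _ (nbhs_filter nu1)) => h ch.
have bh := continuous_bounded_measurable K_compact ch.
rewrite Rintegral_mixture//.
under eq_fun do rewrite Rintegral_mixture//.
apply: cvgD; last exact: cvg_cst.
by apply: cvgM; [exact: cvg_cst|exact: weakstar_integral].
Qed.

Lemma mixture_continuousr (t : {i01 R}) nu1 :
  continuous (fun nu2 : weak => mixture t nu1 nu2 : weak).
Proof.
move=> nu2; apply: (@weakstar_cvg weak (nbhs nu2) _ _ (nbhs_filter nu2)) => h ch.
have bh := continuous_bounded_measurable K_compact ch.
rewrite Rintegral_mixture//.
under eq_fun do rewrite Rintegral_mixture//.
apply: cvgD; first exact: cvg_cst.
by apply: cvgM; [exact: cvg_cst|exact: weakstar_integral].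
Qed.

Lemma continuous_closure (T : topologicalType) (g : T -> T) (E F : set T) :
  continuous g -> (forall x, E x -> closure F (g x)) ->
  forall x, closure E x -> closure F (g x).
Proof.
move=> cg EF x Ex; apply: closed_closure => B Bgx.
have [y [Ey By]] := Ex _ (cg x B Bgx).
by exists (g y); split => //; exact: EF.
Qed.

(** The two arguments pass to the closure one at a time, so separate continuity of mixing
    suffices. *)
Lemma closure_mixture (t : {i01 R}) (E : set (probability KG R)) :
  (forall nu1 nu2, E nu1 -> E nu2 -> closure (E : set weak) (mixture t nu1 nu2)) ->
  forall nu1 nu2, closure (E : set weak) nu1 -> closure (E : set weak) nu2 ->
  closure (E : set weak) (mixture t nu1 nu2).
Proof.
move=> Emix nu1 nu2 Enu1.
apply: (continuous_closure (@mixture_continuousr t nu1)) => nu2' Enu2.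
move: nu1 Enu1; apply: (continuous_closure (@mixture_continuousl t nu2')) => nu1' Enu1.
exact: Emix.
Qed.

End weakstar.

(** * Convexity of the closure in the presence of mass one half *)

Section non_strongly_ergodic.
Context (R : realType) (G : groupType) d (X : measurableType d).
Context (mu : probability X R) (f : G -> X -> X) (e : nat -> G).
Hypothesis f_pmp : pmp_action mu f.
Hypothesis f_erg : ergodic mu f.
Hypothesis e_surj : forall g, exists n, e n = g.
Context (K : ptopologicalType).
Hypothesis K_compact : compact [set: K].
Local Notation KG := (baireConfig R G K).
Local Notation E := (factor_measures (K := K) mu f).

Lemma mixture_factor_measures (t : {i01 R}) (nu1 nu2 : probability KG R) :
  almost_invariant_mass mu f t%:num -> E nu1 -> E nu2 ->
  closure (E : set (weakstar R G K)) (mixture t nu1 nu2).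
Proof.
move=> tV [phi1 mphi1 nu1E] [phi2 mphi2 nu2E].
have [A Ai At] := mass_sequence e_surj tV.
have [mA _] := Ai.
have /choice[nu nuE] n :
    exists nu : probability KG R, forall B, nu B = pushforward mu
      (equivariant_map f (glue phi1 phi2 (A n)) : X -> KG) B.
  by apply: factor_measure_exists => //; exact: measurable_glue.
have nucvg : nu @ \oo --> (mixture t nu1 nu2 : weakstar R G K).
  apply: weakstar_cvg => h ch.
  have bh := continuous_bounded_measurable K_compact ch.
  have mPhi phi mphi := @measurable_equivariant_map R G K d X f phi K_compact
    (pmp_measurable f_pmp) mphi.
  rewrite Rintegral_mixture// (Rintegral_pushforward (mPhi _ mphi1) nu1E bh).
  rewrite (Rintegral_pushforward (mPhi _ mphi2) nu2E bh).
  under eq_fun => n.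
    rewrite (Rintegral_pushforward (mPhi _ (measurable_glue (mA n) mphi1 mphi2))
      (fun B _ => nuE n B) bh).
    over.
  exact: (cvg_Rintegral_glue f_pmp f_erg e_surj K_compact Ai At).
move=> B /nucvg [n _ /(_ n (leqnn n)) Bn].
exists (nu n); split => //.
by exists (glue phi1 phi2 (A n)); [exact: measurable_glue|move=> C _; exact: nuE].
Qed.

Lemma convex_weakstar_closure_factor_measures :
  almost_invariant_mass mu f 2^-1 -> convex_measures (weakstar_closure E).
Proof.
move=> hV t nu1 nu2 [inv1 cl1] [inv2 cl2]; split.
  move=> g A mA.
  change (mixture t nu1 nu2 (Defs.shift g @^-1` A) = mixture t nu1 nu2 A).
  by rewrite !mixtureE inv1// inv2.
apply: closure_mixture => // nu1' nu2'; apply: mixture_factor_measures.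
(* A single mass strictly between 0 and 1 supplies every weight [t]. *)
apply: (mass_full f_pmp f_erg e_surj hV); last by apply/andP.
by rewrite invr_gt0 ltr0n/= invf_lt1 ?ltr1n.
Qed.

End non_strongly_ergodic.

(** * Continuous approximation of Baire sets *)

Lemma cvg_pr_bigcap0 d (T : measurableType d) (R : realType)
    (P : probability T R) (F : nat -> set T) :
  (forall n, measurable (F n)) -> nonincreasing_seq F -> \bigcap_n F n = set0 ->
  pr P (F n) @[n --> \oo] --> 0.
Proof.
move=> mF niF F0.
have F0y : (P (F 0%N) < +oo)%E by rewrite (le_lt_trans (probability_le1 P _))// ltry.
have mcapF : measurable (\bigcap_n F n) by rewrite F0.
have := nonincreasing_cvg_mu F0y mF mcapF niF.
by rewrite F0 measure0 => /fine_cvg.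
Qed.

Section lusin.
Context (R : realType) (T : ptopologicalType).
Local Notation BT := (g_sigma_algebraType (baire_generators R T)).
Context (nu : probability BT R).

(** Exact agreement off a set of small mass makes the Boolean operations immediate: [1 - h] handles
    complements and the maximum handles unions. *)
Definition lusin (A : set BT) : Prop := measurable A /\
  forall eps : R, 0 < eps -> exists (h : T -> R) (E : set BT),
    [/\ continuous h, forall w, 0 <= h w <= 1, measurable E,
        pr nu E <= eps & forall w, ~ E w -> h w = \1_A w].

Lemma measurable_preimage_continuous (h : T -> R) (B : set R) :
  continuous h -> measurable B -> measurable (h @^-1` B : set BT).
Proof.
move=> ch mB; suff mh : measurable_fun [set: BT] (h : BT -> R).
  by rewrite -[X in measurable X]setTI; exact: mh.
apply: (measurability _ (RGenOpens.measurableE R)) => //.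
move=> _ [_ [a [b ->]] <-]; rewrite setTI; apply: sub_sigma_algebra.
by exists h, `]a, b[%classic; split => //; exact: interval_open.
Qed.

Lemma lusin0 : lusin set0.
Proof.
split=> // eps e0; exists (cst 0), set0; split => //.
- by move=> w; exact: cvg_cst.
- by move=> w; rewrite lexx ler01.
- by rewrite pr0 ltW.
- by move=> w _; rewrite indic0.
Qed.

Lemma lusinC A : lusin A -> lusin (~` A).
Proof.
move=> [mA lA]; split; first exact: measurableC.
move=> eps /lA[h [E [ch h01 mE Ee hE]]].
exists (fun w => 1 - h w), E; split => //.
- by move=> w; apply: cvgB; [exact: cvg_cst|exact: ch].
- by move=> w; have /andP[? ?] := h01 w; apply/andP; split; lra.
- move=> w /hE ->; rewrite indicC indicE.
  by case: (_ \in _); rewrite /= ?subrr ?subr0.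
Qed.

Lemma lusinU A B : lusin A -> lusin B -> lusin (A `|` B).
Proof.
move=> [mA lA] [mB lB]; split; first exact: measurableU.
move=> eps e0; have e20 : 0 < eps / 2 by rewrite divr_gt0.
have [h [E [ch h01 mE Ee hE]]] := lA _ e20.
have [k [F [ck k01 mF Fe kF]]] := lB _ e20.
exists (h \max k), (E `|` F); split.
- by move=> w; apply: continuous_max; [exact: ch|exact: ck].
- move=> w; have /andP[h0 h1] := h01 w; have /andP[k0 k1] := k01 w.
  by rewrite /= le_max h0/= ge_max h1.
- exact: measurableU.
- by apply: (le_trans (prU_le _ mE mF)); lra.
- move=> w EF; rewrite /= hE; last by move=> ?; apply: EF; left.
  rewrite kF; last by move=> ?; apply: EF; right.
  rewrite !indicE in_setU; case: (_ \in _); case: (_ \in _) => /=;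
    by rewrite ?maxxx// ?(max_l ler01)// ?(max_r ler01).
Qed.

(** A finite subunion misses at most [eps / 2] of the mass, so its continuous approximant also
    serves the whole union once the missed part joins the exceptional set. *)
Lemma lusin_bigcup (F : nat -> set BT) :
  (forall n, lusin (F n)) -> lusin (\bigcup_n F n).
Proof.
move=> lF; have mF n : measurable (F n) by have [] := lF n.
have mUF : measurable (\bigcup_n F n) by exact: bigcup_measurable.
split=> // eps e0; have e20 : 0 < eps / 2 by rewrite divr_gt0.
pose S n := \big[setU/set0]_(i < n) F i.
have lS n : lusin (S n).
  rewrite /S; elim: n => [|n IH]; first by rewrite big_ord0; exact: lusin0.
  by rewrite big_ord_recr/=; exact: lusinU.
have mS n : measurable (S n) by have [] := lS n.
pose D n := \bigcup_n F n `\` S n.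
have mD n : measurable (D n) by exact: measurableD.
have D0 : pr nu (D n) @[n --> \oo] --> 0.
  apply: cvg_pr_bigcap0 => //.
    move=> i j ij; apply/subsetPset => x [Fx Sx]; split => //.
    move=> Six; apply: Sx; move: Six; rewrite /S -!bigcup_mkord => -[k /= ki Fk].
    by exists k => //=; exact: leq_trans ij.
  apply/seteqP; split => // x Dx; have [[k _ Fk] _] := Dx 0%N I.
  have [_] := Dx k.+1 I; apply; rewrite /S -bigcup_mkord.
  by exists k => /=.
have [n _ /(_ n (leqnn n)) Dn] := (cvgrPdist_lt _ _).1 D0 _ e20.
rewrite /= sub0r normrN ger0_norm ?pr_ge0// in Dn.
have [_ /(_ _ e20)[h [E [ch h01 mE Ee hE]]]] := lS n.
exists h, (E `|` D n); split => //.
- exact: measurableU.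
- by apply: (le_trans (prU_le _ mE (mD n))); lra.
- move=> w ED; rewrite hE; last by move=> ?; apply: ED; left.
  rewrite !indicE; congr (nat_of_bool _)%:R; apply/idP/idP => /set_mem wS; apply/mem_set.
    by move: wS; rewrite /S -bigcup_mkord => -[k _ Fk]; exists k.
  by apply: contrapT => nS; apply: ED; right.
Qed.

(** A ramp in [h] rising from 0 at level [a] to 1 at level [a + 1 / (n + 1)] equals the indicator
    off the strip between these levels. The strips decrease to the empty set, so their masses tend
    to 0. *)
Lemma lusin_ray (h : T -> R) (a : R) : continuous h ->
  lusin (h @^-1` `]a, +oo[).
Proof.
move=> ch; split; first exact: measurable_preimage_continuous.
move=> eps e0.
pose F n := h @^-1` `]a, a + n.+1%:R^-1[%classic : set BT.
have mF n : measurable (F n) by exact: measurable_preimage_continuous.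
have F0 : pr nu (F n) @[n --> \oo] --> 0.
  apply: cvg_pr_bigcap0 => //.
    move=> i j ij; apply/subsetPset => x; rewrite /F /= !in_itv/= => /andP[-> /=].
    by move=> /lt_le_trans; apply; rewrite lerD2l lef_pV2 ?posrE// ler_nat.
  apply/seteqP; split => // x Fx.
  have := Fx 0%N I; rewrite /F /= in_itv/= => /andP[ax _].
  have d0 : 0 < h x - a by rewrite subr_gt0.
  near \oo => n.
  have := Fx n I; rewrite /F /= in_itv/= ax/= -ltrBlDl; apply/negP; rewrite -leNgt ltW//.
  by near: n; exact: (near_infty_natSinv_lt (PosNum d0)).
have [n _ /(_ n (leqnn n)) Fn] := (cvgrPdist_lt _ _).1 F0 _ e0.
rewrite /= sub0r normrN ger0_norm ?pr_ge0// in Fn.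
pose k := (cst 1 \min (cst 0 \max (fun w => n.+1%:R * (h w - a)))) : T -> R.
exists k, (F n); split => //.
- move=> w; apply: continuous_min; first exact: cvg_cst.
  apply: continuous_max; first exact: cvg_cst.
  apply: cvgM; first exact: cvg_cst.
  by apply: cvgB; [exact: ch|exact: cvg_cst].
- by move=> w; rewrite /k /= ge_min lexx/= le_min ler01 le_max lexx.
- exact: ltW.
- move=> w; rewrite /F /= in_itv/= => nF; rewrite /k /= indicE.
  have [aw|wa] := ltP a (h w).
    rewrite mem_set; last by rewrite /= in_itv/= aw.
    rewrite min_l// le_max; apply/orP; right.
    rewrite -ler_pdivrMl// mulr1 lerBrDl leNgt; apply/negP => hn.
    by apply: nF; rewrite aw hn.
  rewrite memNset; last by rewrite /= in_itv/= andbT ltNge wa.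
  rewrite max_l ?min_r//; apply: mulr_ge0_le0 => //; lra.
Unshelve. all: by end_near. Qed.

(** The Lusin sets form a sigma-algebra. For fixed [h] the sets of reals with Lusin preimage form
    one too, which contains the open rays and therefore every open set. *)
Lemma baire_lusin (A : set BT) : measurable A -> lusin A.
Proof.
suff : <<s baire_generators R T >> `<=` lusin by apply.
apply: smallest_sub.
  split; [exact: lusin0|by move=> B; rewrite setTD; exact: lusinC|exact: lusin_bigcup].
move=> _ [h [U [ch /open_measurable mU ->]]].
suff : <<s @RGenOInfty.G R >> `<=` [set U | lusin (h @^-1` U)].
  by apply; have := mU; rewrite [measurable](RGenOInfty.measurableE R).
apply: smallest_sub; last by move=> _ [a ->]; exact: lusin_ray.
split => /=.
- by rewrite preimage_set0; exact: lusin0.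
- by move=> B; rewrite setTD preimage_setC; exact: lusinC.
- by move=> B lB; rewrite preimage_bigcup; exact: lusin_bigcup.
Qed.

End lusin.

(** * Invariant sets of limit measures *)

Section strongly_ergodic_closure.
Context (R : realType) (G : groupType) d (X : measurableType d).
Context (mu : probability X R) (f : G -> X -> X).
Hypothesis f_pmp : pmp_action mu f.
Context (K : ptopologicalType).
Hypothesis K_compact : compact [set: K].
Local Notation KG := (baireConfig R G K).
Local Notation weak := (weakstar R G K).
Local Notation shift := (@Defs.shift G K).

(** The level set where [h] exceeds 1/2 is not seen directly by the weak* topology. Its mass and its
    invariance defect are therefore bounded by integrals of the continuous functions [p] and [q],
    which carry over from [nu] to nearby factor measures. *)
Lemma closure_factor_measures_mass (nu : probability KG R) (A : set KG) :
  weakstar_closure (factor_measures mu f) nu -> measurable A ->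
  (forall g, shift g @^-1` A = A) ->
  almost_invariant_mass mu f (pr nu A).
Proof.
move=> [inv cl] mA Ainv S eps e0.
(* The mass estimate spends four parts [de]; the invariance estimate spends six for the integral of
   [q] under [nu] and one for passing to the factor measure. *)
pose de := eps / 8; have d0 : 0 < de by rewrite divr_gt0.
have [_ /(_ _ d0)[h [E [ch h01 mE Ee hE]]]] := baire_lusin nu mA.
have cs g : continuous (shift g : config G K -> config G K).
  exact: shift_continuous.
have chs g : continuous (fun w : config G K => h (shift g w)).
  by move=> w; apply: continuous_comp; [exact: cs|exact: ch].
(* [p] vanishes where [h] is 0 or 1, and it dominates the distance from [h] to the indicator of its
   level set above 1/2. *)
pose p (w : config G K) := 2 * (h w * (1 - h w)).
have cp : continuous p.
  move=> w; apply: cvgM; first exact: cvg_cst.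
  by apply: cvgM; [exact: ch|apply: cvgB; [exact: cvg_cst|exact: ch]].
(* If [h w <= 1/2 < h (shift g w)], the three terms are at least [h w], [h (shift g w) - h w] and
   [1 - h (shift g w)], which sum to 1. So [q g] dominates the indicator of the invariance
   defect. *)
pose q g (w : config G K) := p w + `|h w - h (shift g w)| + p (shift g w).
have cq g : continuous (q g).
  move=> w; apply: cvgD; last by apply: continuous_comp; [exact: cs|exact: cp].
  apply: cvgD; first exact: cp.
  by apply: cvg_norm; apply: cvgB; [exact: ch|exact: chs].
have bh := continuous_bounded_measurable K_compact ch.
have bp := continuous_bounded_measurable K_compact cp.
have bq g := continuous_bounded_measurable K_compact (cq g).
have bE : bounded_measurable (\1_E : KG -> R) by exact: bm_indic.
have p01 w : 0 <= p w <= 1.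
  by rewrite /p; have /andP[? ?] := h01 w; apply/andP; split; nra.
have p0 w : ~ E w -> p w = 0.
  move=> /hE; rewrite /p indicE => ->.
  by case: (_ \in _); rewrite /= ?subrr ?mul0r ?mulr0.
have nup : \int[nu]_w p w <= de.
  apply: le_trans Ee; rewrite -Rintegral_indic//; apply: bm_Rintegral_le => // w.
  rewrite indicE; have [|] := boolP (w \in E); first by have /andP[] := p01 w.
  by rewrite notin_setE => /p0 ->.
have nuh : `|\int[nu]_w h w - pr nu A| <= de.
  apply: le_trans Ee; rewrite -!Rintegral_indic//.
  apply: bm_dist_Rintegral => //; first exact: bm_indic.
  move=> w; rewrite [\1_E w]indicE; have [_|] := boolP (w \in E).
    rewrite indicE; have /andP[? ?] := h01 w.
    by case: (_ \in _); rewrite ler_norml /=; apply/andP; split; lra.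
  by rewrite notin_setE => /hE ->; rewrite subrr normr0.
(* Off [E] and its preimage under the shift, [h] agrees at both points with the indicator of the
   invariant set [A], so [q g] vanishes. Elsewhere it is at most 3, and both exceptional sets have
   mass at most [de] by invariance of [nu]. *)
have nuq g : \int[nu]_w q g w <= 3 * (de + de).
  have mgE : measurable (shift g @^-1` E : set KG).
    rewrite -[X in measurable X]setTI.
    exact: (measurable_continuous_config (cs g)).
  have prgE : pr nu (shift g @^-1` E) = pr nu E by rewrite /pr inv.
  have bgE : bounded_measurable (\1_(shift g @^-1` E) : KG -> R) by exact: bm_indic.
  apply: (@le_trans _ _ (3 * (pr nu E + pr nu (shift g @^-1` E)))); last first.
    by rewrite prgE; lra.
  rewrite -!Rintegral_indic// -bm_RintegralD// -bm_RintegralZ//; last exact: bmD.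
  apply: bm_Rintegral_le => //; first by apply: bmZ; exact: bmD.
  move=> w; rewrite /q !indicE.
  have /andP[? ?] := p01 w; have /andP[? ?] := p01 (shift g w).
  have /andP[? ?] := h01 w; have /andP[? ?] := h01 (shift g w).
  have q3 : p w + `|h w - h (shift g w)| + p (shift g w) <= 3.
    have : `|h w - h (shift g w)| <= 1 by rewrite ler_norml; apply/andP; split; lra.
    lra.
  have [wE|wE] := boolP (w \in E); first by case: (_ \in _) => /=; lra.
  have [gE|gE] := boolP (w \in _); first by rewrite /=; lra.
  rewrite notin_setE in wE; rewrite notin_setE in gE.
  rewrite !p0// !hE// !indicE.
  have -> : (shift g w \in A) = (w \in A).
    have gA : (shift g @^-1` A) w = A w by rewrite Ainv.
    by apply/idP/idP => /set_mem wA; apply/mem_set; move: wA; rewrite -?gA// gA.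
  by rewrite subrr normr0 /= !addr0 mulr0.
pose close (k : config G K -> R) (nu' : probability KG R) :=
  `|\int[nu]_w k w - \int[nu']_w k w| < de.
have near_close (k : config G K -> R) : continuous k ->
    \forall nu' \near (nu : weak), close k nu'.
  by move=> ck; have /cvgrPdist_lt := @weakstar_integral R G K k ck nu; apply.
have near_q : \forall nu' \near (nu : weak), forall s, s \in S -> close (q s) nu'.
  apply: (@near_all_seq weak _ G S (fun s => close (q s)) (nbhs_filter _)) => s _.
  exact: near_close.
have [nu' [[phi mphi nu'E] [[hh pp] qq]]] :=
  cl _ (filterI (filterI (near_close h ch) (near_close p cp)) near_q).
pose Phi : X -> KG := equivariant_map f phi.
have mPhi : measurable_fun setT Phi.
  exact: (@measurable_equivariant_map R G K d X f phi K_compact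
    (pmp_measurable f_pmp) mphi).
have intE (k : config G K -> R) : continuous k ->
    \int[nu']_w k w = \int[mu]_x k (Phi x).
  move=> ck; apply: Rintegral_pushforward => //.
  exact: continuous_bounded_measurable.
have bPhi (k : config G K -> R) : continuous k ->
    bounded_measurable (fun x => k (Phi x)).
  move=> ck; have [mk [M hM]] := continuous_bounded_measurable K_compact ck.
  split; last by exists M => x.
  rewrite -[X in measurable_fun _ X]/((k : KG -> R) \o Phi).
  exact: (measurableT_comp mk mPhi).
rewrite /close (intE _ ch) in hh; rewrite /close (intE _ cp) in pp.
have PhiS s x : Phi (f s x) = shift s (Phi x).
  by apply/funext => g; rewrite /Phi /equivariant_map /Defs.shift (pmp_actM f_pmp).
pose B := [set x | 1 / 2 < h (Phi x)].
have mB : measurable B.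
  rewrite (_ : B = (fun x => h (Phi x)) @^-1` `]1 / 2, +oo[); last first.
    by apply/seteqP; split => x; rewrite /B /= in_itv/= andbT.
  rewrite -[X in measurable X]setTI; exact: (proj1 (bPhi _ ch)).
exists B; split => // [|s sS].
  have Bh : `|pr mu B - \int[mu]_x h (Phi x)| <= \int[mu]_x p (Phi x).
    rewrite -Rintegral_indic//; apply: bm_dist_Rintegral => //.
    - exact: bm_indic.
    - exact: bPhi.
    - exact: bPhi.
    move=> x; rewrite indicE /p; have /andP[? ?] := h01 (Phi x).
    have [/set_mem xB|] := boolP (x \in B).
      by move: xB; rewrite /B /= ler_norml => ?; apply/andP; split; nra.
    rewrite notin_setE /B /= => /negP; rewrite -leNgt ler_norml => ?.
    by apply/andP; split; nra.
  have : eps = 8 * de by rewrite /de; lra.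
  move: hh pp Bh nuh nup; rewrite !ltr_norml !ler_norml.
  by move=> /andP[? ?] /andP[? ?] /andP[? ?] /andP[? ?] ? ?; apply/andP; split; lra.
have mfB := measurable_preimage_action f_pmp s mB.
have mD := measurableD mfB mB.
have Bq : pr mu (f s @^-1` B `\` B) <= \int[mu]_x q s (Phi x).
  rewrite -Rintegral_indic//; apply: bm_Rintegral_le => //.
  - exact: bm_indic.
  - exact: bPhi.
  move=> x; rewrite indicE /q.
  have /andP[? ?] := p01 (Phi x); have /andP[? ?] := p01 (shift s (Phi x)).
  have := normr_ge0 (h (Phi x) - h (shift s (Phi x))).
  have [/set_mem[]|_] := boolP (x \in _); last by rewrite /=; lra.
  rewrite /B /= PhiS => h1 /negP; rewrite -leNgt => h2 _.
  have /andP[? ?] := h01 (Phi x); have /andP[? ?] := h01 (shift s (Phi x)).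
  rewrite ler0_norm; last lra.
  rewrite /p; nra.
have := qq s sS; rewrite /close (intE _ (cq s)).
have : eps = 8 * de by rewrite /de; lra.
have := nuq s; rewrite ltr_norml => ? ? /andP[? ?]; lra.
Qed.

End strongly_ergodic_closure.

(** * The dichotomy between ergodic limits and convexity *)

Theorem theorem4 (R : realType) (G : groupType) (G_countable : countable [set: G])
    (d : measure_display) (X : measurableType d) (X_std : standard_borel R X)
    (mu : probability X R) (f : G -> X -> X)
    (f_pmp : pmp_action mu f) (f_erg : ergodic mu f)
    (K : ptopologicalType) (K_compact : compact [set: K]) :
  (strongly_ergodic mu f ->
     weakstar_closure (factor_measures (K:=K) mu f) `<=` @ergodic_measures R G K) /\
  (~ strongly_ergodic mu f ->
     convex_measures (weakstar_closure (factor_measures (K:=K) mu f))).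
Proof.
have [e e_surj] : exists e : nat -> G, forall g, exists n, e n = g.
  have /countable_injP[i i_inj] := G_countable.
  (* The injection into the naturals is inverted; indices outside its range are sent to [1%g]. *)
  have /choice[e eP] n : exists x : G, forall g, i g = n -> x = g.
    have [[x ix]|nx] := pselect (exists x, i x = n).
      by exists x => g ig; apply: i_inj; rewrite ?in_setT// ix ig.
    by exists 1%g => g ig; exfalso; apply: nx; exists g.
  by exists e => g; exists (i g); exact: eP.
split=> [[_ nwc] nu nucl|nse]; last first.
  apply: (convex_weakstar_closure_factor_measures f_pmp f_erg e_surj K_compact).
  (* As [f] is ergodic, strong ergodicity can only fail through weak containment. *)
  apply: (weakly_contains_mass f_pmp); apply: contrapT => nwc.
  by apply: nse; split.
split; first by have [] := nucl.
move=> A mA Ainv.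
have nuV := closure_factor_measures_mass f_pmp K_compact nucl mA Ainv.
have [nu0|nu0] := eqVneq (pr nu A) 0; first by left; rewrite -prE// nu0.
have [nu1|nu1] := eqVneq (pr nu A) 1; first by right; rewrite -prE// nu1.
(* An invariant set of intermediate mass would make 1/2 the mass of almost invariant sets, which
   strong ergodicity excludes. *)
exfalso; apply: nwc; apply: (mass_weakly_contains f_pmp).
apply: (mass_full f_pmp f_erg e_surj nuV); last first.
  by rewrite invr_ge0 ler0n/= invf_le1 ?ler1n.
by rewrite !lt_neqAle eq_sym nu0 nu1 pr_ge0 pr_le1.
Qed.
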